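(* Let $\mu,\nu$ be probability measures on $\mathcal{X}$ with $\mu \ll \nu$, and suppose the partially observed Markov process is observable (i.e. $N$ step observable for some finite $N\in\mathbb{N}$). Then the one step predictors $\pi_{n-}^{\mu}$ and $\pi_{n-}^{\nu}$ merge weakly $P^{\mu}$-almost surely: there is an event of $P^{\mu}$-probability one on which, for every $f \in C_b(\mathcal{X})$, $\lim_{n\to\infty}\left|\int f\,d\pi_{n-}^{\mu}-\int f\,d\pi_{n-}^{\nu}\right| = 0$.
   Context: Setting: $\mathcal{X},\mathcal{Y},\mathcal{Z}$ are Polish spaces with Borel $\sigma$-fields. $T$ is a transition kernel on $\mathcal{X}$; $\{Z_n\}_{n\ge 0}$ is an i.i.d. $\mathcal{Z}$-valued sequence with law $Q$, independent of the state process; $h:\mathcal{X}\times\mathcal{Z}\to\mathcal{Y}$ is measurable. The state process $\{X_n\}$ is a Markov chain with transition kernel $T$ and initial law $X_0\sim\mu$, and the observations are $Y_n=h(X_n,Z_n)$. $P^{\mu}$ denotes the law of $\{(X_n,Y_n)\}_{n\ge0}$ on $(\mathcal{X}\times\mathcal{Y})^{\mathbb{Z}_+}$ when $X_0\sim\mu$, and $E^\mu$ its expectation. The one step predictor is $\pi_{n-}^{\mu}(\cdot)=P^{\mu}(X_n\in\cdot\mid Y_0,\dots,Y_{n-1})$ and the filter is $\pi_n^{\mu}(\cdot)=P^{\mu}(X_n\in\cdot\mid Y_0,\dots,Y_n)$. $C_b(\mathcal{X})$ is the set of bounded continuous real functions on $\mathcal{X}$. For $N\in\mathbb{N}$, let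 $P(dy_{[1,N]}\mid X_1=x)$ denote the conditional law of $(Y_1,\dots,Y_N)$ given $X_1=x$ (which does not depend on the prior). The model is $N$ step observable if for every $f\in C_b(\mathcal{X})$ and $\epsilon>0$ there is a bounded measurable $g:\mathcal{Y}^N\to\mathbb{R}$ with $\sup_{x\in\mathcal{X}}\left|f(x)-\int_{\mathcal{Y}^N} g(y_{[1,N]})P(dy_{[1,N]}\mid X_1=x)\right|<\epsilon$; it is observable if it is $N$ step observable for some finite $N$. *)

(* Defs.v *)
From HB Require Import structures.
From mathcomp Require Import all_boot all_order all_algebra.
From mathcomp Require Import all_classical all_reals all_analysis measurable_realfun.
Set Implicit Arguments. Unset Strict Implicit. Unset Printing Implicit Defensive.
Import Order.TTheory GRing.Theory Num.Theory.
Import numFieldNormedType.Exports.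
Local Open Scope classical_set_scope.
Local Open Scope ring_scope.

Definition Borel (T : topologicalType) := g_sigma_algebraType (@open T).

(* Polish space, presented with a fixed complete compatible metric:
   Hausdorff (so the pseudometric is a metric), complete (built into
   completePseudoMetricType) and separable. *)
Definition polish (R : realType) (T : completePseudoMetricType R) : Prop :=
  hausdorff_space T /\ exists D : set T, countable D /\ dense D.

Definition bounded_fun (R : realType) (T : Type) (f : T -> R) : Prop :=
  exists M : R, forall x, `|f x| <= M.

Definition Cb (R : realType) (T : topologicalType) (f : T -> R) : Prop :=
  continuous f /\ bounded_fun f.

Definition cylN (R : realType) (Y : completePseudoMetricType R) (N : nat)
  : set (set (seq Y)) :=
  [set C | exists B : nat -> set (Borel Y), (forall i, measurable (B i)) /\
     C = [set ys : seq Y | size ys = N /\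
            forall i, (i < N)%N -> B i (nth point ys i)]].

Definition measurable_YN (R : realType) (Y : completePseudoMetricType R)
  (N : nat) (g : seq Y -> R) : Prop :=
  forall U : set R, measurable U ->
    <<s cylN N >> [set ys : seq Y | size ys = N /\ U (g ys)].

(* finite-dimensional distributions of the Markov chain: for sets A_0..A_m,
   chain_int T A i m x = 1_{A_i}(x) * int T(x,dx_{i+1}) 1_{A_{i+1}}(x_{i+1}) ...
   up to index i+m. *)
Fixpoint chain_int (R : realType) (X : completePseudoMetricType R)
  (T : R.-pker (Borel X) ~> (Borel X)) (A : nat -> set (Borel X))
  (i m : nat) (x : Borel X) {struct m} : \bar R :=
  match m with
  | 0 => (\1_(A i) x)%:E
  | m'.+1 => ((\1_(A i) x)%:E *
              \int[T x]_y chain_int T A i.+1 m' y)%E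
  end.

(* E[ g(Y_1,...,Y_m) | X_1 = x ] (more generally with an already observed
   prefix ys) computed through the model: Y_k = h(X_k,Z_k), Z_k ~ Q i.i.d.,
   X_{k+1} ~ T(X_k, .). *)
Fixpoint obs_int (R : realType) (X Y Z : completePseudoMetricType R)
  (T : R.-pker (Borel X) ~> (Borel X)) (Q : probability (Borel Z) R)
  (h : X -> Z -> Y) (g : seq Y -> R) (m : nat) (ys : seq Y) (x : Borel X)
  {struct m} : \bar R :=
  match m with
  | 0 => (g ys)%:E
  | m'.+1 => (\int[Q]_z \int[T x]_x' obs_int T Q h g m' (rcons ys (h x z)) x')%E
  end.

Definition N_observable (R : realType) (X Y Z : completePseudoMetricType R)
  (T : R.-pker (Borel X) ~> (Borel X)) (Q : probability (Borel Z) R)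
  (h : X -> Z -> Y) (N : nat) : Prop :=
  forall f : X -> R, Cb f -> forall eps : R, 0 < eps ->
    exists g : seq Y -> R,
      [/\ measurable_YN N g, bounded_fun g &
          exists2 d : R, d < eps &
            forall x : X, (`|(f x)%:E - obs_int T Q h g N [::] x| <= d%:E)%E].

Definition observable (R : realType) (X Y Z : completePseudoMetricType R)
  (T : R.-pker (Borel X) ~> (Borel X)) (Q : probability (Borel Z) R)
  (h : X -> Z -> Y) : Prop :=
  exists N : nat, N_observable T Q h N.

(* Under P, (X_n) is a Markov chain with kernel T and initial law m, and
   (Z_n) is i.i.d. with law Q, independent of (X_n): this is the
   characterization of the joint law by its finite-dimensional
   distributions. *)
Definition pomp_law (R : realType) (X Z : completePseudoMetricType R)
  (dO : measure_display) (O : measurableType dO)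
  (T : R.-pker (Borel X) ~> (Borel X)) (Q : probability (Borel Z) R)
  (m : probability (Borel X) R) (P : probability O R)
  (Xs : nat -> O -> Borel X) (Zs : nat -> O -> Borel Z) : Prop :=
  forall (n : nat) (A : nat -> set (Borel X)) (B : nat -> set (Borel Z)),
    (forall i, measurable (A i)) -> (forall i, measurable (B i)) ->
    P (\bigcap_(i in `I_n.+1) (Xs i @^-1` A i `&` Zs i @^-1` B i)) =
    ((\prod_(i < n.+1) Q (B i)) * \int[m]_x chain_int T A 0 n x)%E.

Definition obs_sigma (R : realType) (Y : completePseudoMetricType R)
  (dO : measure_display) (O : measurableType dO)
  (Ys : nat -> O -> Borel Y) (n : nat) : set (set O) :=
  <<s [set G | exists i, (i < n)%N /\
        exists B : set (Borel Y), measurable B /\ G = Ys i @^-1` B] >>.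

Definition is_predictor (R : realType) (X Y : completePseudoMetricType R)
  (dO : measure_display) (O : measurableType dO) (P : probability O R)
  (Xs : nat -> O -> Borel X) (Ys : nat -> O -> Borel Y)
  (pi : nat -> O -> probability (Borel X) R) : Prop :=
  forall n (A : set (Borel X)), measurable A ->
    (forall U : set (\bar R), measurable U ->
        obs_sigma Ys n ((fun w => pi n w A) @^-1` U)) /\
    (forall G : set O, obs_sigma Ys n G ->
        (\int[P]_(w in G) pi n w A)%E = P (G `&` Xs n @^-1` A)).

(* Main.v *)
Require Import Defs.
From HB Require Import structures.
From mathcomp Require Import all_boot all_order all_algebra.
From mathcomp Require Import all_classical all_reals all_analysis measurable_realfun.
From mathcomp Require Import ring lra.
Set Implicit Arguments. Unset Strict Implicit. Unset Printing Implicit Defensive.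
Import Order.TTheory GRing.Theory Num.Theory.
Import numFieldNormedType.Exports.
Local Open Scope classical_set_scope.
Local Open Scope ring_scope.

(* By observability, the integral of [f] against a predictor is, up to a uniform
   error, the integral of a bounded [g] against the conditional law of the next
   [N] observations given the past ones. Hence it is enough that these
   conditional laws under [Pmu] and [Pnu] merge in total variation, [Pmu]-almost
   surely (a finite-horizon Blackwell-Dubins theorem); the exceptional event then
   depends neither on [f] nor on [g].

   Let [M_n] be the density of [Pmu] with respect to [Pmu + Pnu] on the first [n]
   observations. If [G_n] depends on the first [n + N] observations and has
   conditional probabilities [p_n] and [q_n] given the first [n] ones, then
   [M_n (1 - M_n) (p_n - q_n)] is dominated in [L^2 (Pmu + Pnu)] by
   [M_(n + N) - M_n]. The martingale [M] is bounded, so its increments are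
   orthogonal with square-summable norms: [M_n (1 - M_n) (p_n - q_n)] tends to 0
   almost surely without any martingale convergence theorem. Moreover [M_n] is
   bounded away from 0 almost surely for [Pmu], and [1 - M_n] for [Pnu], hence
   also for [Pmu] since [mu `<< nu] gives absolute continuity of [Pmu] with
   respect to [Pnu] on trajectories. Finally the sigma-algebra of observation
   blocks is generated by a countable algebra, so choosing for [G_n], depending on
   the past, the first set of that algebra on which the two conditional laws
   differ by more than [e] turns this into convergence in total variation. *)

(** * Disintegration along probability kernels *)

Section integral_mrestr.
Context d (T : measurableType d) (R : realType).
Variables (m : {measure set T -> \bar R}) (D : set T) (mD : measurable D).
Local Open Scope ereal_scope.

(** The complement of [D] is null for the restricted measure, and the two measures agree on subsets
    of [D]. Integrals over an event thus become integrals against a finite measure on the whole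
    space. *)
Lemma ge0_integral_mrestr (f : T -> \bar R) :
  measurable_fun setT f -> (forall x, 0 <= f x) ->
  \int[mrestr m mD]_x f x = \int[m]_(x in D) f x.
Proof.
move=> mf f0; rewrite -(setUv D) ge0_integral_setU//=.
- rewrite (@null_set_integral _ _ _ (mrestr m mD) (~` D))//.
  + rewrite adde0; apply: eq_measure_integral => A mA AD.
    by rewrite /= /mrestr setIidl.
  + exact: measurableC.
  + exact: measurable_funTS.
  + by rewrite /= /mrestr setICl measure0.
- exact: measurableC.
- by rewrite setUv.
- by apply/disj_setPS; rewrite setICr.
Qed.

End integral_mrestr.

Section image_measure.
Context d1 d2 (U : measurableType d1) (V : measurableType d2) (R : realType).
Variables (f : U -> V) (mf : measurable_fun setT f).
Local Open Scope ereal_scope.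

(* [pushforward] does not record the measurability of the map, so that its
   measure structure cannot be inferred. *)
Definition image_measure (m : set U -> \bar R) of measurable_fun setT f :=
  pushforward m f.

Section measure.
Variable m : {measure set U -> \bar R}.

Let image0 : image_measure m mf set0 = 0.
Proof. by rewrite /image_measure /pushforward preimage_set0 measure0. Qed.

Let image_ge0 A : 0 <= image_measure m mf A.
Proof. exact: measure_ge0. Qed.

Let image_sigma_additive : semi_sigma_additive (image_measure m mf).
Proof. exact: (@measure_semi_sigma_additive _ _ _ (pushforward m f)). Qed.

HB.instance Definition _ := isMeasure.Build _ _ _
  (image_measure m mf) image0 image_ge0 image_sigma_additive.

Lemma ge0_integral_image (g : V -> \bar R) D : measurable D ->
  measurable_fun setT g -> (forall x, 0 <= g x) ->
  \int[image_measure m mf]_(x in D) g x = \int[m]_(x in f @^-1` D) g (f x).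
Proof.
move=> mD mg g0; rewrite -(ge0_integral_pushforward mf m mD)//.
exact: measurable_funTS.
Qed.

End measure.

Section finite_measure.
Variable m : {finite_measure set U -> \bar R}.

Let image_fin : fin_num_fun (image_measure m mf).
Proof.
by move=> A mA; apply: fin_num_measure; rewrite -[X in measurable X]setTI; exact: mf.
Qed.

HB.instance Definition _ := @Measure_isFinite.Build _ _ _
  (image_measure m mf) image_fin.

End finite_measure.

End image_measure.

Section kernel_disintegration.
Context d1 d2 (U : measurableType d1) (V : measurableType d2) (R : realType).
Local Open Scope ereal_scope.

Section disintegration.
Variables (l : {finite_measure set U -> \bar R}) (k : R.-pker U ~> V).

(** [l] is viewed as a kernel from [unit], and [kp] sends [u] to the law of [(u, v)] with [v] drawn
    from [k u]. Their composition is then a measure on the product with a known integral formula. *)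
Let kc (_ : unit) : {measure set U -> \bar R} := l.

Let kc_measurable A : measurable A -> measurable_fun [set: unit] (kc ^~ A).
Proof. by move=> mA; exact: measurable_cst. Qed.

HB.instance Definition _ := isKernel.Build _ _ _ _ _ kc kc_measurable.

Let kc_uub : measure_fam_uub kc.
Proof.
exists (fine (l setT) + 1)%R => x; rewrite EFinD fineK ?fin_num_measure//.
by rewrite lteDl ?fin_num_measure// lte01.
Qed.

HB.instance Definition _ := @Kernel_isFinite.Build _ _ _ _ R kc kc_uub.

Let mpair (x : unit * U) : measurable_fun [set: V] (fun v => (x.2, v)).
Proof. by apply: measurable_fun_pair => //; exact: measurable_cst. Qed.

Let kp (x : unit * U) : {measure set (U * V)%type -> \bar R} :=
  image_measure (k x.2) (mpair x).

Let kpE x W : kp x W = k x.2 (xsection W x.2).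
Proof. by rewrite /kp/= /image_measure /pushforward xsectionE. Qed.

Let kp_measurable W : measurable W -> measurable_fun setT (kp ^~ W).
Proof.
move=> mW; under eq_fun do rewrite kpE.
apply: (measurableT_comp (f := fun u => k u (xsection W u))) => //.
by apply: measurable_fun_xsection_finite_kernel; rewrite inE.
Qed.

HB.instance Definition _ := isKernel.Build _ _ _ _ _ kp kp_measurable.

Let kp_prob x : kp x setT = 1.
Proof. by rewrite kpE xsectionE preimage_setT prob_kernel. Qed.

HB.instance Definition _ := @Kernel_isProbability.Build _ _ _ _ R kp kp_prob.

(** Measurable rectangles form a pi-system generating the product sigma-algebra, so the finite
    measure [m] is the composition of [l] with [k], whose integrals are iterated. *)
Lemma kernel_disintegration (m : {finite_measure set (U * V)%type -> \bar R}) :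
  (forall E C, measurable E -> measurable C ->
    m (E `*` C) = \int[l]_(u in E) k u C) ->
  forall f, measurable_fun setT f -> (forall x, 0 <= f x) ->
    \int[m]_x f x = \int[l]_u \int[k u]_v f (u, v).
Proof.
move=> mE f mf f0.
have := integral_kcomp kc kp tt f0 mf.
rewrite [X in _ = X -> _](_ : _ = \int[l]_u \int[k u]_v f (u, v)); last first.
  apply: eq_integral => u _.
  by rewrite /kp/= (ge0_integral_image (mpair (tt, u)))// preimage_setT.
move=> <-; apply: eq_measure_integral => W mW _.
apply: (measure_unique [set A `*` B | A in measurable & B in measurable]
   (fun=> setT)) => //.
- by rewrite measurable_prod_measurableType.
- move=> _ _ [X1 mX1 [X2 mX2 <-]] [Y1 mY1 [Y2 mY2 <-]].
  exists (X1 `&` Y1); first exact: measurableI.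
  by exists (X2 `&` Y2); [exact: measurableI|rewrite setXI].
- by move=> _; exists setT => //; exists setT => //; rewrite setXTT.
- by rewrite bigcup_const.
- move=> _ [E mE0 [C mC <-]]; rewrite [LHS](mE _ _ mE0 mC).
  transitivity (\int[l]_u kp (tt, u) (E `*` C)); last by [].
  rewrite integral_mkcond; apply: eq_integral => u _; rewrite kpE/= patchE.
  case: ifPn => uE; first by rewrite in_xsectionX.
  by rewrite notin_xsectionX// measure0.
- by move=> _; rewrite ltey_eq fin_num_measure.
Qed.

End disintegration.

Context d0 (T : measurableType d0).
Variables (m : {finite_measure set T -> \bar R}) (D : set T) (mD : measurable D).
Variables (u : T -> U) (v : T -> V).
Hypotheses (mu : measurable_fun setT u) (mv : measurable_fun setT v).
Variable k : R.-pker U ~> V.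

Lemma measurable_kernel_integral (f : U * V -> \bar R) :
  measurable_fun setT f -> (forall x, 0 <= f x) ->
  measurable_fun setT (fun x => \int[k x]_y f (x, y)).
Proof. by move=> mf f0; exact: measurable_fun_integral_finite_kernel. Qed.

(** The hypothesis makes [k (u w)] the conditional law of [v] given [u] on the event [D]. Pushing
    the restriction of [m] to [D] forward along [(u, v)] and along [u] reduces the formula to a
    disintegration on the product. *)
Lemma integral_conditional_kernel :
  (forall E C, measurable E -> measurable C ->
    m (D `&` u @^-1` E `&` v @^-1` C) =
    \int[m]_(w in D `&` u @^-1` E) k (u w) C) ->
  forall f, measurable_fun setT f -> (forall x, 0 <= f x) ->
    \int[m]_(w in D) f (u w, v w) = \int[m]_(w in D) \int[k (u w)]_y f (u w, y).
Proof.
move=> mE f mf f0.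
pose r := mrestr m mD.
have muv : measurable_fun setT (fun w => (u w, v w)).
  exact: measurable_fun_pair.
have mkf := measurable_kernel_integral mf f0.
have kf0 x : 0 <= \int[k x]_y f (x, y) by exact: integral_ge0.
rewrite -(ge0_integral_mrestr m mD (f := fun w => f (u w, v w)))//; last first.
  exact: measurableT_comp.
rewrite -(ge0_integral_mrestr m mD (f := fun w => \int[k (u w)]_y f (u w, y)))//;
  last first.
  exact: (measurableT_comp mkf).
transitivity (\int[image_measure (mrestr m mD) muv]_x f x).
  by rewrite ge0_integral_image// preimage_setT.
transitivity (\int[image_measure (mrestr m mD) mu]_x \int[k x]_y f (x, y));
  last first.
  by rewrite ge0_integral_image// preimage_setT.
apply: kernel_disintegration => // E C mE' mC.
rewrite ge0_integral_image//; last exact: measurable_kernel.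
have mkC : measurable_fun setT (fun w => k (u w) C).
  exact: (measurableT_comp (measurable_kernel k C mC)).
have muE : measurable (u @^-1` E) by rewrite -[X in measurable X]setTI; exact: mu.
rewrite [RHS]integral_mkcond ge0_integral_mrestr//; last 2 first.
- exact/(measurable_restrictT _ muE).1/measurable_funTS.
- by move=> w; apply: erestrict_ge0.
rewrite -integral_mkcondr -mE// /= /image_measure /pushforward /mrestr.
by congr (m _); rewrite /= setIC setIA.
Qed.

End kernel_disintegration.

(** * Densities on sub-sigma-algebras *)

Section bounded_measurable.
Context d (T : measurableType d) (R : realType).
Implicit Types f g : T -> R.

Definition bounded_measurable f :=
  measurable_fun setT f /\ exists M, forall x, `|f x| <= M.

Lemma bounded_measurable_cst (c : R) : bounded_measurable (fun _ => c).
Proof. by split; [exact: measurable_cst|exists `|c|]. Qed.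

Lemma bounded_measurable01 f : measurable_fun setT f ->
  (forall x, 0 <= f x <= 1) -> bounded_measurable f.
Proof.
by move=> mf f01; split => //; exists 1 => x; have /andP[f0 f1] := f01 x; rewrite ger0_norm.
Qed.

Lemma bounded_measurableD f g : bounded_measurable f -> bounded_measurable g ->
  bounded_measurable (fun x => f x + g x).
Proof.
move=> [mf [M fM]] [mg [N gN]]; split; first exact: measurable_funD.
by exists (M + N) => x; rewrite (le_trans (ler_normD _ _))// lerD.
Qed.

Lemma bounded_measurableB f g : bounded_measurable f -> bounded_measurable g ->
  bounded_measurable (fun x => f x - g x).
Proof.
move=> [mf [M fM]] [mg [N gN]]; split; first exact: measurable_funB.
by exists (M + N) => x; rewrite (le_trans (ler_normB _ _))// lerD.
Qed.

Lemma bounded_measurableM f g : bounded_measurable f -> bounded_measurable g ->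
  bounded_measurable (fun x => f x * g x).
Proof.
move=> [mf [M fM]] [mg [N gN]]; split; first exact: measurable_funM.
by exists (M * N) => x; rewrite normrM ler_pM.
Qed.

Lemma bounded_measurable_indic A : measurable A -> bounded_measurable (\1_A : T -> R).
Proof.
move=> mA; apply: bounded_measurable01; first exact: measurable_indic.
by move=> x; rewrite indicE; case: (_ \in _); rewrite /= lexx ler01.
Qed.

Variable m : {finite_measure set T -> \bar R}.

Lemma bounded_measurable_integrable f : bounded_measurable f ->
  m.-integrable setT (EFin \o f).
Proof.
move=> [mf [M fM]]; apply: measurable_bounded_integrable => //.
  by rewrite ltey_eq fin_num_measure.
exists M; split; first exact: num_real.
by move=> N MN x _ /=; rewrite (le_trans (fM x))// ltW.
Qed.

Lemma EFin_Rintegral f : bounded_measurable f ->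
  (\int[m]_x f x)%:E = (\int[m]_x (f x)%:E)%E.
Proof.
by move=> bf; rewrite /Rintegral fineK// integrable_fin_num//; exact: bounded_measurable_integrable.
Qed.

End bounded_measurable.

(** Pushing a measure along the identity into a coarser sigma-algebra restricts it to that
    sigma-algebra. *)
Lemma g_sigma_algebra_id_measurable d (T : measurableType d) (G : set (set T)) :
  G `<=` measurable ->
  measurable_fun setT (id : T -> g_sigma_algebraType G).
Proof.
move=> Gm _ A mA; rewrite setTI preimage_id.
by apply: smallest_sub mA => //; exact: sigma_algebra_measurable.
Qed.

Lemma bounded_measurable_sub d (T : measurableType d) (R : realType)
    (G : set (set T)) (f : T -> R) : G `<=` measurable ->
  bounded_measurable (f : g_sigma_algebraType G -> R) -> bounded_measurable f.
Proof.
move=> Gm [mf bf]; split => //.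
exact: (measurableT_comp mf (g_sigma_algebra_id_measurable Gm)).
Qed.

Section finite_measure_add.
Context d (T : measurableType d) (R : realType).
Variables m1 m2 : {finite_measure set T -> \bar R}.

Let measure_add_fin : fin_num_fun (measure_add m1 m2).
Proof. by move=> A mA; rewrite measure_addE fin_numD !fin_num_measure. Qed.

HB.instance Definition _ := Measure.copy (measure_add m1 m2)
  (msum (fun n => if n is 0%N then m1 : {measure set T -> \bar R} else m2) 2).

HB.instance Definition _ := @Measure_isFinite.Build _ _ _
  (measure_add m1 m2) measure_add_fin.

End finite_measure_add.

(* [M] is the density of [P] with respect to [P + Q] on the sigma-algebra
   generated by [G]. *)
Lemma conditional_density d (T : measurableType d) (R : realType)
    (P Q : {finite_measure set T -> \bar R}) (G : set (set T)) :
  G `<=` measurable -> exists M : T -> R,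
  [/\ measurable_fun setT (M : g_sigma_algebraType G -> R),
      forall x, 0 <= M x <= 1 &
      forall u, bounded_measurable (u : g_sigma_algebraType G -> R) ->
        \int[P]_x u x = \int[P]_x (u x * M x) + \int[Q]_x (u x * M x)].
Proof.
move=> Gm; pose idm := g_sigma_algebra_id_measurable Gm.
pose P' := image_measure P idm; pose Q' := image_measure Q idm.
pose S' := measure_add P' Q'.
have S'E A : S' A = (P' A + Q' A)%E by exact: measure_addE.
have PS : P' `<< S'.
  apply/null_content_dominatesP => A mA; rewrite [X in X = _ -> _]S'E => /eqP.
  by rewrite padde_eq0 ?measure_ge0// => /andP[/eqP].
have P'S' A : measurable A -> (P' A <= S' A)%E.
  by move=> mA; rewrite S'E leeDl.
pose f := Radon_Nikodym_SigmaFinite.f P' S'.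
have f0 x : (0 <= f x)%E by exact: Radon_Nikodym_SigmaFinite.f_ge0.
have ffin x : f x \is a fin_num by exact: Radon_Nikodym_SigmaFinite.f_fin_num.
have intf : S'.-integrable setT f by exact: Radon_Nikodym_SigmaFinite.f_integrable.
have mf : measurable_fun setT f by exact: measurable_int intf.
(* The Radon-Nikodym derivative is at most 1 only almost everywhere; truncation makes the bound hold
   at every point without changing integrals. *)
pose M x := Num.min (fine (f x)) 1.
have mM : measurable_fun setT (M : g_sigma_algebraType G -> R).
  by apply: measurable_minr => //; exact: measurableT_comp.
have M01 x : 0 <= M x <= 1.
  by rewrite /M le_min fine_ge0//= ler01 ge_min lexx orbT.
pose D := [set x | (1 < f x)%E].
have mD : measurable (D : set (g_sigma_algebraType G)).
  rewrite -[D]setTI; exact: emeasurable_fun_o_infty.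
have fM : ae_eq S' setT f (EFin \o M).
  (* Where [f > 1], the nonnegative function [f - 1] has integral [P' D - S' D <= 0], hence vanishes
     almost everywhere. *)
  have : ae_eq S' D (fun x => f x - 1)%E (cst 0%E).
    apply/ae_eq_integral_abs => //.
      by apply: emeasurable_funB; exact: measurable_funTS.
    apply/eqP; rewrite eq_le integral_ge0 ?andbT; last by move=> *; exact: abse_ge0.
    under eq_integral => x xD.
      rewrite gee0_abs; last by rewrite sube_ge0// ltW//; move: xD; rewrite inE.
      over.
    rewrite integralB//; last 2 first.
    - exact: integrableS intf.
    - exact: finite_measure_integrable_cst.
    rewrite -Radon_Nikodym_SigmaFinite.f_integral// integral_cst// mul1e.
    by rewrite sube_le0 P'S'.
  apply: filterS => x h _ /=; rewrite /M.
  have [f1|f1] := leP (fine (f x)) 1; first by rewrite fineK.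
  have /h /eqP : D x by rewrite /D/= -(fineK (ffin x)) lte_fin.
  by rewrite sube_eq// add0e => /eqP.
have main u : (forall x, 0 <= u x) ->
    bounded_measurable (u : g_sigma_algebraType G -> R) ->
    \int[P]_x u x = \int[P]_x (u x * M x) + \int[Q]_x (u x * M x).
  move=> u0 bu.
  have bM := bounded_measurable01 mM M01.
  have buM := bounded_measurableM bu bM.
  have [bu' buM'] := (bounded_measurable_sub Gm bu, bounded_measurable_sub Gm buM).
  apply: EFin_inj; rewrite EFinD !EFin_Rintegral//.
  have [mu _] := bu; have [muM _] := buM.
  have uM0 x : 0 <= u x * M x by rewrite mulr_ge0//; case/andP: (M01 x).
  transitivity (\int[P']_x (u x)%:E)%E.
    rewrite ge0_integral_image ?preimage_setT//.
    exact/measurable_EFinP.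
  transitivity (\int[S']_x (u x * M x)%:E)%E; last first.
    rewrite ge0_integral_measure_add//; last 2 first.
    - by move=> x _; rewrite lee_fin.
    - exact/measurable_EFinP.
    by rewrite !ge0_integral_image ?preimage_setT//; exact/measurable_EFinP.
  rewrite -(Radon_Nikodym_SigmaFinite.change_of_variables PS); last 3 first.
  - by move=> x; rewrite lee_fin.
  - by [].
  - exact/measurable_EFinP.
  apply: ae_eq_integral => //.
  - by apply: emeasurable_funM => //; exact/measurable_EFinP.
  - exact/measurable_EFinP.
  - by apply: filterS fM => x h _ /=; rewrite EFinM -[(M x)%:E]h.
(* A signed [u] bounded by [c] is handled by subtracting the nonnegative cases of [u + c] and of the
   constant [c]. *)
exists M; split => // u bu; have [mu [c uc]] := bu.
have c0 : 0 <= c by exact: le_trans (uc point).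
have bc : bounded_measurable ((fun=> c) : g_sigma_algebraType G -> R).
  exact: bounded_measurable_cst.
have bM := bounded_measurable01 mM M01.
have buc := bounded_measurableD bu bc.
have uc0 x : 0 <= u x + c.
  by have := uc x; rewrite ler_norml => /andP[+ _]; rewrite -subr_ge0 opprK.
have := main _ uc0 buc.
have := main _ (fun=> c0) bc.
have intb (m : {finite_measure set T -> \bar R}) g :
    bounded_measurable (g : g_sigma_algebraType G -> R) -> m.-integrable setT (EFin \o g).
  by move=> /(bounded_measurable_sub Gm); exact: bounded_measurable_integrable.
have hD (m : {finite_measure set T -> \bar R}) : \int[m]_x ((u x + c) * M x) =
    \int[m]_x (u x * M x) + \int[m]_x (c * M x).
  under eq_Rintegral do rewrite mulrDl.
  by rewrite RintegralD//; apply: intb; exact: bounded_measurableM.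
rewrite !hD RintegralD//; [|exact: intb..].
lra.
Qed.

(** * Merging of finite-horizon conditional probabilities *)

(** By monotone convergence the series of squares has a finite integral, so it converges almost
    everywhere and its terms tend to 0. *)
Lemma ae_cvg0_sum_sqr d (T : measurableType d) (R : realType)
    (P : {finite_measure set T -> \bar R}) (w : nat -> T -> R) (C : R) :
  (forall n, bounded_measurable (w n)) ->
  (forall K, \sum_(0 <= n < K) \int[P]_x (w n x * w n x) <= C) ->
  {ae P, forall x, w ^~ x @ \oo --> 0}.
Proof.
move=> bw wC.
have bww n : bounded_measurable (fun x => w n x * w n x) by exact: bounded_measurableM.
have mww n : measurable_fun setT (fun x => (w n x * w n x)%:E).
  by apply/measurable_EFinP; case: (bww n).
have ww0 n x : (0 <= (w n x * w n x)%:E)%E by rewrite lee_fin -expr2 sqr_ge0.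
have intw : P.-integrable setT (fun x => \sum_(n <oo) (w n x * w n x)%:E)%E.
  apply/integrableP; split; first exact: ge0_emeasurable_sum.
  under eq_integral do rewrite gee0_abs ?nneseries_ge0//.
  rewrite integral_nneseries//; apply: (@le_lt_trans _ _ C%:E); last exact: ltry.
  apply: lime_le.
    by apply: is_cvg_nneseries => n _ _; exact: integral_ge0.
  apply: nearW => K; have := wC K; rewrite -lee_fin; apply: le_trans.
  by rewrite -sumEFin; apply: lee_sum => n _; rewrite EFin_Rintegral.
apply: filterS (integrable_ae measurableT intw) => x /(_ I) fin.
have cv : cvgn (series (fun n => w n x * w n x)).
  apply: nondecreasing_is_cvgn.
    apply/nondecreasing_seqP => n.
    by rewrite seriesSr lerDl -expr2 sqr_ge0.
  exists (fine (\sum_(n <oo) (w n x * w n x)%:E)%E) => _ [K _ <-].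
  rewrite -lee_fin fineK// /series/= -sumEFin.
  exact: nneseries_lim_ge.
have /cvgr0Pnorm_lt h := cvg_series_cvg_0 cv.
apply/cvgr0Pnorm_lt => e e0.
have /h : 0 < e * e by exact: mulr_gt0.
apply: filterS => n; rewrite normrM => we.
rewrite ltNge; apply/negP => ew; move: we; apply/negP; rewrite -leNgt.
by rewrite ler_pM// ltW.
Qed.

(** The sum telescopes to the [N] values of [a] from [K] onwards minus the first [N] ones. *)
Lemma sum_shift_le (R : realType) (a : nat -> R) (c : R) N K :
  (forall n, 0 <= a n <= c) ->
  \sum_(0 <= n < K) (a (n + N)%N - a n) <= c *+ N.
Proof.
move=> ac; have ha n : 0 <= a n by case/andP: (ac n).
have shift m k : \sum_(m <= i < m + k) a i = \sum_(0 <= i < k) a (i + m)%N.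
  by rewrite -{1}[m]add0n big_addn addKn.
rewrite sumrB lerBlDr.
apply: (@le_trans _ _ (\sum_(0 <= n < N + K) a n)).
  have -> : \sum_(0 <= n < N + K) a n =
      \sum_(0 <= n < N) a n + \sum_(N <= n < N + K) a n.
    by rewrite -big_cat_nat//= leq_addr.
  by rewrite shift lerDr sumr_ge0.
rewrite addnC (big_cat_nat (n := K))//= ?leq_addr// addrC lerD2r shift.
apply: (@le_trans _ _ (\sum_(0 <= i < N) c)).
  by apply: ler_sum => n _; case/andP: (ac (n + K)%N).
by rewrite big_const_nat subn0 iter_addr_0.
Qed.

Section merging.
Context d (T : measurableType d) (R : realType).
Variable G : nat -> set (set T).
Hypothesis Gm : forall n, G n `<=` measurable.
Hypothesis G_mono : forall m n, (m <= n)%N -> <<s G m >> `<=` <<s G n >>.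

Local Notation adapted n u := (bounded_measurable (u : g_sigma_algebraType (G n) -> R)).

Lemma adapted_le m n (u : T -> R) : (m <= n)%N -> adapted m u -> adapted n u.
Proof.
move=> mn [mu bu]; split => // mT A mA.
by apply: (G_mono mn); exact: mu.
Qed.

Lemma adapted_bounded_measurable n (u : T -> R) : adapted n u -> bounded_measurable u.
Proof. exact: bounded_measurable_sub. Qed.

Lemma g_sigma_algebra_bigcup_sub n : <<s G n >> `<=` <<s \bigcup_k G k >>.
Proof. by apply: sub_smallest2r; [exact: smallest_sigma_algebra|move=> A GA; exists n]. Qed.

Lemma bigcup_generators_measurable : <<s \bigcup_k G k >> `<=` measurable.
Proof.
apply: smallest_sub; first exact: sigma_algebra_measurable.
by move=> A [n _]; exact: Gm.
Qed.

(* The process [M] is the likelihood ratio of [P] with respect to [P + Q]: before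
   it first falls below [a] the mass of [P] is at most [a] times that of [P + Q]. *)
Lemma density_bounded_below (P Q : probability T R) (M : nat -> T -> R) :
  (forall n, adapted n (M n)) ->
  (forall n (u : T -> R), adapted n u ->
    \int[P]_x u x = \int[P]_x (u x * M n x) + \int[Q]_x (u x * M n x)) ->
  exists A, [/\ <<s \bigcup_k G k >> A, P A = 0%E &
    forall x, ~ A x -> exists c, 0 < c /\ forall n, c <= M n x].
Proof.
move=> aM PM.
pose B a n := [set x | M n x < a].
have mB a n : <<s G n >> (B a n).
  have [mM _] := aM n.
  have : measurable (setT `&` (M n : g_sigma_algebraType (G n) -> R) @^-1` `]-oo, a[).
    by apply: mM => //; exact: measurable_itv.
  by rewrite setTI; congr (<<s _ >> _); apply/seteqP; split => x; rewrite /B/= in_itv.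
pose D a n := seqDU (B a) n.
have sD a n : <<s G n >> (D a n).
  rewrite /D /seqDU; apply: (@measurableD _ (g_sigma_algebraType (G n))); first exact: mB.
  apply: (@bigsetU_measurable _ (g_sigma_algebraType (G n))) => i _.
  by apply: (G_mono (ltnW (ltn_ord i))); exact: mB.
have mD a n : measurable (D a n).
  by apply: bigcup_generators_measurable; exact: g_sigma_algebra_bigcup_sub.
pose S := measure_add P Q.
have SE A : S A = (P A + Q A)%E by exact: measure_addE.
(* The [P]-mass of this event is the integral over it of [M n], which is below [a] there, against
   [P + Q]. *)
have PD a n : (P (D a n) <= a%:E * S (D a n))%E.
  have a1 : adapted n (\1_(D a n) : T -> R).
    exact: (@bounded_measurable_indic _ (g_sigma_algebraType (G n)) R _ (sD a n)).
  have b1 := adapted_bounded_measurable a1.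
  have bM := adapted_bounded_measurable (aM n).
  have Pi (m : probability T R) : m (D a n) = (\int[m]_x \1_(D a n) x)%:E.
    by rewrite EFin_Rintegral// integral_indic// setIT.
  have aZ (m : probability T R) :
      a * \int[m]_x \1_(D a n) x = \int[m]_x (a * \1_(D a n) x).
    by rewrite RintegralZl//; exact: bounded_measurable_integrable.
  rewrite SE !Pi -EFinD -EFinM lee_fin [leLHS](PM n)// mulrDr !aZ.
  have ba := bounded_measurableM (bounded_measurable_cst T a) b1.
  have bm := bounded_measurableM b1 bM.
  have le x : \1_(D a n) x * M n x <= a * \1_(D a n) x.
    rewrite indicE; have [xD|_] := boolP (x \in D a n); last by rewrite mul0r mulr0.
    rewrite mul1r mulr1 ltW//; move: xD; rewrite inE /D /seqDU => -[].
    by rewrite /B.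
  by apply: lerD; apply: le_Rintegral => //; exact: bounded_measurable_integrable.
(* The first-passage events are disjoint, so their bounds add up to [a] times the total mass 2 of
   [P + Q]. *)
have PB a : (0 <= a) -> (P (\bigcup_n B a n) <= (2 * a)%:E)%E.
  move=> a0; rewrite seqDU_bigcup_eq -/(D a).
  have tD : trivIset setT (D a) by exact: trivIset_seqDU.
  have mS (m : {measure set T -> \bar R}) :
      m (\bigcup_n D a n) = (\sum_(n <oo) m (D a n))%E.
    by rewrite measure_semi_bigcup//; exact: bigcup_measurable.
  rewrite [leLHS]mS.
  apply: (@le_trans _ _ (\sum_(n <oo) (a%:E * S (D a n)))%E).
    by apply: lee_nneseries => [n _ _|n _]; [exact: measure_ge0|exact: PD].
  rewrite nneseriesZl; last by move=> n _; exact: measure_ge0.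
  rewrite -[X in (_ * X)%E](mS (measure_add P Q)).
  rewrite mulrC EFinM lee_wpmul2l ?lee_fin//.
  rewrite [leLHS]SE.
  apply: (@le_trans _ _ (1 + 1)%E); last by rewrite -EFinD lee_fin.
  by apply: leeD; apply: probability_le1; exact: bigcup_measurable.
(* The exceptional event is that [M] falls below every level [1 / (k + 1)] at some time. Its
   [P]-mass is at most [2 / (k + 1)] for every [k], hence 0. *)
exists (\bigcap_k \bigcup_n B k.+1%:R^-1 n); split.
- apply: (@bigcap_measurable _ (g_sigma_algebraType (\bigcup_k G k))) => [|k _].
    by exists 0%N.
  apply: (@bigcup_measurable _ (g_sigma_algebraType (\bigcup_k G k))) => n _.
  exact: (g_sigma_algebra_bigcup_sub (mB _ n)).
- have mBk k : measurable (\bigcup_n B k.+1%:R^-1 n).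
    apply: bigcup_measurable => n _; apply: bigcup_generators_measurable.
    exact: (g_sigma_algebra_bigcup_sub (mB _ n)).
  apply/eqP; rewrite eq_le measure_ge0 andbT.
  apply/lee_addgt0Pr => e e0; rewrite add0e.
  have [k /= ke] : exists k : nat, 2 * k.+1%:R^-1 <= e.
    have [k _ /(_ k (leqnn k))/ltW] := near_infty_natSinv_lt (PosNum (divr_gt0 e0 (ltr0n _ 2))).
    by exists k; rewrite mulrC -ler_pdivlMr.
  apply: (@le_trans _ _ (P (\bigcup_n B k.+1%:R^-1 n))).
    apply: le_measure; rewrite ?inE//; first exact: bigcapT_measurable.
    exact: bigcap_inf.
  by apply: le_trans (PB _ _) _; rewrite ?lee_fin.
- move=> x nA; have [k kx] : exists k, ~ (\bigcup_n B k.+1%:R^-1 n) x.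
    by apply/existsNP => h; apply: nA => k _; exact: h.
  exists k.+1%:R^-1; split; first by rewrite invr_gt0.
  by move=> n; rewrite leNgt; apply/negP => Mk; apply: kx; exists n.
Qed.

Variables (P Q : probability T R) (N : nat) (p q g : nat -> T -> R).
Hypothesis PQ : forall A, <<s \bigcup_k G k >> A -> Q A = 0%E -> P A = 0%E.
Hypotheses (ap : forall n, adapted n (p n)) (aq : forall n, adapted n (q n)).
Hypotheses (ag : forall n, adapted (n + N) (g n)) (g01 : forall n x, 0 <= g n x <= 1).
Hypothesis Pp : forall n (u : T -> R), adapted n u ->
  \int[P]_x (u x * p n x) = \int[P]_x (u x * g n x).
Hypothesis Qq : forall n (u : T -> R), adapted n u ->
  \int[Q]_x (u x * q n x) = \int[Q]_x (u x * g n x).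

Let E u := \int[P]_x u x + \int[Q]_x u x.

Let ED u v : bounded_measurable u -> bounded_measurable v ->
  E (fun x => u x + v x) = E u + E v.
Proof.
move=> bu bv; rewrite /E !RintegralD//; [|exact: bounded_measurable_integrable..].
by rewrite addrACA.
Qed.

Let EB u v : bounded_measurable u -> bounded_measurable v ->
  E (fun x => u x - v x) = E u - E v.
Proof.
move=> bu bv; rewrite /E !RintegralB//; [|exact: bounded_measurable_integrable..].
by rewrite opprD addrACA.
Qed.

Let E_le u v : bounded_measurable u -> bounded_measurable v ->
  (forall x, u x <= v x) -> E u <= E v.
Proof.
by move=> bu bv uv; apply: lerD; apply: le_Rintegral => //; exact: bounded_measurable_integrable.
Qed.

Let eqE u v : u =1 v -> E u = E v.
Proof. by move=> /funext ->. Qed.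

(* With [M n] the density of [P] with respect to [P + Q] on the first [n]
   observations, [M (1 - M) (p - q)] is square-summable, because its square is
   dominated by the increments of the bounded sequence [E (M n ^ 2)]. *)
Lemma ae_merging : {ae P, forall x, (fun n => p n x - q n x) @ \oo --> 0}.
Proof.
have /choice[M hM] : forall n, exists M : T -> R, [/\ adapted n M,
    forall x, 0 <= M x <= 1 &
    forall u : T -> R, adapted n u -> \int[P]_x u x = E (fun x => u x * M x)].
  move=> n.
  have [M [mM M01 PM]] := conditional_density P Q (Gm (n := n)).
  by exists M; split => //; exact: bounded_measurable01.
have aM n : adapted n (M n) by case: (hM n).
have M01 n x : 0 <= M n x <= 1 by case: (hM n).
have PM n (u : T -> R) : adapted n u -> \int[P]_x u x = E (fun x => u x * M n x).
  by case: (hM n) => _ _; exact.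
have bT n (u : T -> R) : adapted n u -> bounded_measurable u.
  exact: adapted_bounded_measurable.
have bD := @bounded_measurableD _ T R; have bB := @bounded_measurableB _ T R.
have bM := @bounded_measurableM _ T R.
have aMM n := @bounded_measurableM _ (g_sigma_algebraType (G n)) R.
have aBB n := @bounded_measurableB _ (g_sigma_algebraType (G n)) R.
have ac n (c : R) := @bounded_measurable_cst _ (g_sigma_algebraType (G n)) R c.
(* The densities of [P] and [Q] with respect to [P + Q] add up to 1, so that of [Q] is [1 - M n]. *)
have QM n (u : T -> R) : adapted n u -> \int[Q]_x u x = E (fun x => u x * (1 - M n x)).
  move=> au; rewrite (eqE (v := fun x => u x - u x * M n x)); last first.
    by move=> x; rewrite mulrBr mulr1.
  rewrite EB; [|exact: bT au|exact: bM (bT _ _ au) (bT _ _ (aM n))].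
  by rewrite -PM// /E addrC addKr.
pose w n x := M n x * (1 - M n x) * (p n x - q n x).
have a1M n : adapted n (fun x => 1 - M n x) by exact: aBB (ac n 1) (aM n).
have aw n : adapted n (w n).
  by apply: (aMM n); [exact: (aMM n) (aM n) (a1M n)|exact: (aBB n) (ap n) (aq n)].
pose a n := E (fun x => M n x * M n x).
have bw n : bounded_measurable (w n) by exact: bT (aw n).
have bMn n : bounded_measurable (M n) by exact: bT (aM n).
have bg n : bounded_measurable (g n) by exact: bT (ag n).
have bp n : bounded_measurable (p n) by exact: bT (ap n).
have bq n : bounded_measurable (q n) by exact: bT (aq n).
have wa n : E (fun x => w n x * w n x) <= a (n + N)%N - a n.
  pose D x := M (n + N)%N x - M n x.
  have bDl : bounded_measurable D by exact: bB (bMn _) (bMn _).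
  (* Orthogonality of martingale increments: [M n] is the projection of [M (n + N)], so the cross
     term has expectation [a n]. *)
  have ED2 : E (fun x => D x * D x) = a (n + N)%N - a n.
    have h : E (fun x => M (n + N)%N x * M n x) = a n.
      rewrite /a -[RHS](PM n)// (PM (n + N)%N); last exact: adapted_le (leq_addr _ _) (aM n).
      by apply: eqE => x; rewrite mulrC.
    rewrite (eqE (v := fun x => (M (n + N)%N x * M (n + N)%N x - M (n + N)%N x * M n x) -
       (M (n + N)%N x * M n x - M n x * M n x))); last by move=> x; rewrite /D; ring.
    have b1 := bM _ _ (bMn (n + N)%N) (bMn (n + N)%N).
    have b2 := bM _ _ (bMn (n + N)%N) (bMn n).
    have b3 := bM _ _ (bMn n) (bMn n).
    rewrite EB; [|exact: bB|exact: bB]; rewrite !EB// h /a; ring.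
  pose wM x := w n x * M n x.
  have awM : adapted n wM by exact: (aMM n) (aw n) (aM n).
  (* With the density at time [n + N] the expectation becomes an integral against [P], where [g n]
     may be replaced by [p n]. *)
  have e1 : E (fun x => w n x * g n x * M (n + N)%N x) = E (fun x => w n x * p n x * M n x).
    rewrite -PM; last first.
      apply: (aMM (n + N)%N); last exact: ag.
      exact: adapted_le (leq_addr _ _) (aw n).
    by rewrite -Pp// (PM n)//; exact: (aMM n) (aw n) (ap n).
  (* With the density at time [n], the factor [M n] is absorbed in the test function [wM]. The
     integral then splits into a [P]-part, where [g n] becomes [p n], and a [Q]-part, where it
     becomes [q n]. *)
  have e2 : E (fun x => w n x * g n x * M n x) =
      E (fun x => wM x * p n x * M n x + wM x * q n x * (1 - M n x)).
    transitivity (E (fun x => wM x * g n x)).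
      by apply: eqE => x; rewrite /wM mulrAC.
    rewrite ED; last 2 first.
    - exact: bM (bM _ _ (bT _ _ awM) (bp n)) (bMn n).
    - exact: bM (bM _ _ (bT _ _ awM) (bq n)) (bT _ _ (a1M n)).
    rewrite -PM; last exact: (aMM n) awM (ap n).
    rewrite -QM; last exact: (aMM n) awM (aq n).
    by rewrite Pp// Qq.
  (* The difference of the two previous expressions is [w * M * (1 - M) * (p - q)], which is
     [w ^ 2]: this is the reason for the choice of [w]. *)
  have e3 : E (fun x => w n x * g n x * D x) = E (fun x => w n x * w n x).
    rewrite (eqE (v := fun x => w n x * g n x * M (n + N)%N x - w n x * g n x * M n x));
      last by move=> x; rewrite mulrBr.
    have bwg := bM _ _ (bw n) (bg n).
    have bwM := bT _ _ awM.
    rewrite EB; [|exact: bM bwg (bMn _)|exact: bM bwg (bMn _)].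
    rewrite e1 e2 -EB; last 2 first.
    - exact: bM (bM _ _ (bw n) (bp n)) (bMn n).
    - apply: bD; first exact: bM (bM _ _ bwM (bp n)) (bMn n).
      exact: bM (bM _ _ bwM (bq n)) (bT _ _ (a1M n)).
    by apply: eqE => x; rewrite /wM /w; ring.
  (* Since [0 <= g n <= 1], the inequality [2 w g D <= w ^ 2 + D ^ 2] holds; as the left side has
     expectation [2 E (w ^ 2)], it gives [E (w ^ 2) <= E (D ^ 2)]. *)
  have : E (fun x => w n x * g n x * D x + w n x * g n x * D x) <=
         E (fun x => w n x * w n x + D x * D x).
    apply: E_le.
    - by apply: bD; exact: bM (bM _ _ (bw n) (bg n)) bDl.
    - by apply: bD; [exact: bM (bw n) (bw n)|exact: (bM _ _ bDl bDl)].
    move=> x; have /andP[g0 g1] := g01 n x.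
    rewrite -subr_ge0.
    have -> : w n x * w n x + D x * D x - (w n x * g n x * D x + w n x * g n x * D x) =
      (w n x - g n x * D x) ^+ 2 + (1 - g n x) * (1 + g n x) * D x ^+ 2 by ring.
    rewrite addr_ge0 ?sqr_ge0// mulr_ge0 ?sqr_ge0// mulr_ge0 ?subr_ge0//.
    by rewrite addr_ge0.
  rewrite !ED//; last 4 first.
  - exact: bM (bw n) (bw n).
  - exact: (bM _ _ bDl bDl).
  - exact: bM (bM _ _ (bw n) (bg n)) bDl.
  - exact: bM (bM _ _ (bw n) (bg n)) bDl.
  by rewrite e3 lerD2l ED2.
have a02 n : 0 <= a n <= 2.
  apply/andP; split.
    by rewrite /a addr_ge0// Rintegral_ge0// => x _; rewrite -expr2 sqr_ge0.
  apply: le_trans (E_le (v := cst 1) _ _ _) _.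
  - exact: bM (bMn n) (bMn n).
  - exact: bounded_measurable_cst.
  - by move=> x /=; have /andP[M0 M1] := M01 n x; rewrite mulr_ile1.
  - have e1 (m : probability T R) : \int[m]_x (cst 1) x = 1.
      by rewrite Rintegral_cst//= [X in fine X](probability_setT m) mul1r.
    by rewrite /E !e1.
have w0 : {ae P, forall x, w ^~ x @ \oo --> 0}.
  apply: (@ae_cvg0_sum_sqr _ _ _ P w (2 *+ N)) => // K.
  apply: le_trans (sum_shift_le N K a02).
  apply: ler_sum => n _; apply: le_trans (wa n).
  by rewrite /E lerDl Rintegral_ge0// => x _; rewrite -expr2 sqr_ge0.
have [A [mA PA0 Ac]] := density_bounded_below aM PM.
(* The same bound is applied with [P] and [Q] exchanged, [1 - M n] being the density of [Q];
   absolute continuity then makes the exceptional event null for [P] as well. *)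
have [B [mB QB0 Bc]] : exists A, [/\ <<s \bigcup_k G k >> A, Q A = 0%E &
    forall x, ~ A x -> exists c, 0 < c /\ forall n, c <= 1 - M n x].
  apply: (@density_bounded_below Q P) => // n u au.
  by rewrite (QM n)// /E addrC.
have PB0 := PQ mB QB0.
have nA : {ae P, forall x, ~ A x}.
  by exists A; split => //; [exact: bigcup_generators_measurable|move=> x /contrapT].
have nB : {ae P, forall x, ~ B x}.
  by exists B; split => //; [exact: bigcup_generators_measurable|move=> x /contrapT].
apply: filterS (filterI w0 (filterI nA nB)) => x [wx].
move=> [/Ac[c1 [c10 c1M]] /Bc[c2 [c20 c2M]]].
apply/cvgr0Pnorm_lt => e e0.
(* At [x] the weight [M n * (1 - M n)] is at least [c1 * c2] for all [n], so [p n - q n] inherits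
   the limit of [w n]. *)
move/cvgr0Pnorm_lt: wx => /(_ (c1 * c2 * e)).
have c12 : 0 < c1 * c2 by exact: mulr_gt0.
move=> /(_ (mulr_gt0 c12 e0)); apply: filterS => n.
rewrite /w normrM => we; rewrite -(ltr_pM2l c12); apply: le_lt_trans we.
apply: ler_wpM2r => //.
rewrite ger0_norm; first by rewrite ler_pM// ltW.
by have /andP[M0 M1] := M01 n x; rewrite mulr_ge0 ?subr_ge0.
Qed.

End merging.

(** * Total variation on countably generated spaces *)

Section total_variation.
Context d (T : measurableType d) (R : realType).
Variables (l1 l2 : probability T R) (e : R).
Local Notation Delta A := (`|fine (l1 A) - fine (l2 A)|).

(** Monotone limits of sets preserve the bound, so the monotone class theorem carries it from a ring
    to everything that the ring generates. *)
Lemma total_variation_sigma_algebra (G : set (set T)) :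
  setring G -> G setT -> G `<=` measurable ->
  (forall A, G A -> Delta A <= e) -> forall A, <<s G >> A -> Delta A <= e.
Proof.
move=> rG GT Gm Ge A sA.
have cvg_Delta (F : (set T)^nat) B :
    l1 (F n) @[n --> \oo] --> l1 B -> l2 (F n) @[n --> \oo] --> l2 B ->
    measurable B -> (forall n, Delta (F n) <= e) -> Delta B <= e.
  move=> F1 F2 mB Fe.
  have {}F1 : fine (l1 (F n)) @[n --> \oo] --> fine (l1 B).
    by apply: fine_cvg; rewrite fineK// fin_num_measure.
  have {}F2 : fine (l2 (F n)) @[n --> \oo] --> fine (l2 B).
    by apply: fine_cvg; rewrite fineK// fin_num_measure.
  have F12 : Delta (F n) @[n --> \oo] --> Delta B by apply: cvg_norm; exact: cvgB.
  rewrite -(cvg_lim _ F12)//; apply: limr_le; first exact: cvgP F12.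
  exact: nearW.
pose H := [set B | measurable B /\ Delta B <= e].
(* As [setT] belongs to [G], the sigma-ring generated by [G] is a sigma-algebra, so it contains
   [A]. *)
suff /(_ A)[] : <<sr G >> `<=` H => //.
  apply: smallest_sub sA => [|B GB]; last exact: sub_g_sigma_ring.
  have [r0 rD rU] := @smallest_sigma_ring _ G.
  split => // B rB; apply: rD => //; exact: sub_g_sigma_ring.
apply: monotone_setring_sub_g_sigma_ring => //; last by move=> B GB; split; [exact: Gm|exact: Ge].
split=> F mF HF.
- have mU : measurable (\bigcup_n F n) by apply: bigcup_measurable => n _; case: (HF n).
  split => //; apply: (cvg_Delta F) => //; last by move=> n; case: (HF n).
  + by apply: nondecreasing_cvg_mu => // n; case: (HF n).
  + by apply: nondecreasing_cvg_mu => // n; case: (HF n).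
- have mI : measurable (\bigcap_n F n) by apply: bigcapT_measurable => n; case: (HF n).
  split => //; apply: (cvg_Delta F) => //; last by move=> n; case: (HF n).
  + apply: nonincreasing_cvg_mu => //; last by move=> n; case: (HF n).
    by rewrite ltey_eq fin_num_measure//; case: (HF 0%N).
  + apply: nonincreasing_cvg_mu => //; last by move=> n; case: (HF n).
    by rewrite ltey_eq fin_num_measure//; case: (HF 0%N).
Qed.

Hypothesis e_ge0 : 0 <= e.
Hypothesis l12 : forall A, measurable A -> Delta A <= e.

(* Binary expansion: [g] is the average of the indicator of [1/2 <= g] and of
   the function [2 g - 1_{1/2 <= g}], which is again [0, 1]-valued. *)
Let total_variation_dyadic K (g : T -> R) :
  measurable_fun setT g -> (forall x, 0 <= g x <= 1) ->
  `|\int[l1]_x g x - \int[l2]_x g x| <= e + 2^-1 ^+ K.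
Proof.
elim: K g => [|K IH] g mg g01.
  have i01 (l : probability T R) : 0 <= \int[l]_x g x <= 1.
    apply/andP; split; first by apply: Rintegral_ge0 => x _; case/andP: (g01 x).
    have -> : 1 = \int[l]_x (cst 1 x) :> R.
      by rewrite Rintegral_cst//= [X in fine X](probability_setT l) mul1r.
    apply: le_Rintegral => //; last by move=> x _; case/andP: (g01 x).
    - by apply: bounded_measurable_integrable; exact: bounded_measurable01.
    - by apply: bounded_measurable_integrable; exact: bounded_measurable_cst.
  have /andP[a0 a1] := i01 l1; have /andP[b0 b1] := i01 l2.
  have := lerB a1 b0; have := lerB a0 b1; rewrite subr0 sub0r expr0 => h1 h2.
  by rewrite (@le_trans _ _ 1)// ?lerDr// ler_norml h1 h2.
pose B := [set x | 2^-1 <= g x].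
have mB : measurable B.
  rewrite -[B]setTI (_ : B = g @^-1` `[2^-1, +oo[); last first.
    by apply/seteqP; split => x; rewrite /B/= in_itv/= andbT.
  by apply: mg => //; exact: measurable_itv.
pose g' x := 2 * g x - \1_B x.
have bB : bounded_measurable (\1_B : T -> R) by exact: bounded_measurable_indic.
have bg : bounded_measurable g by exact: bounded_measurable01.
have mg' : measurable_fun setT g'.
  by apply: measurable_funB; [exact: measurable_funM|exact: measurable_indic].
have g'01 x : 0 <= g' x <= 1.
  rewrite /g' indicE; have /andP[a b] := g01 x.
  have [|] := boolP (x \in B); rewrite ?inE ?notin_setE /B/= => h;
    last move/negP: h; rewrite -?ltNge.
    by apply/andP; split; lra.
  by move=> h; apply/andP; split; lra.
have bg' := bounded_measurable01 mg' g'01.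
have ig (l : probability T R) :
    \int[l]_x g x = 2^-1 * fine (l B) + 2^-1 * \int[l]_x g' x.
  have -> : fine (l B) = \int[l]_x \1_B x.
    by rewrite /Rintegral integral_indic// setIT.
  rewrite -!RintegralZl//; [|exact: bounded_measurable_integrable..].
  rewrite -RintegralD//; last 2 first.
  - apply: bounded_measurable_integrable.
    by apply: bounded_measurableM => //; exact: bounded_measurable_cst.
  - apply: bounded_measurable_integrable.
    by apply: bounded_measurableM => //; exact: bounded_measurable_cst.
  by apply: eq_Rintegral => x _; rewrite /g'; lra.
rewrite !ig exprS.
have -> : 2^-1 * fine (l1 B) + 2^-1 * \int[l1]_x g' x -
    (2^-1 * fine (l2 B) + 2^-1 * \int[l2]_x g' x) =
    2^-1 * (fine (l1 B) - fine (l2 B)) + 2^-1 * (\int[l1]_x g' x - \int[l2]_x g' x) by ring.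
apply: le_trans (ler_normD _ _) _; rewrite !normrM ger0_norm ?invr_ge0//.
have := l12 mB; have := IH _ mg' g'01; lra.
Qed.

(** The affine map [t |-> t / (2 M) + 1/2] brings [g] into [[0, 1]], where the dyadic error tends to
    0, and divides differences of integrals by [2 M]. The case [M = 0] is separate because of this
    division. *)
Lemma total_variation_integral (g : T -> R) M : measurable_fun setT g ->
  (forall x, `|g x| <= M) -> `|\int[l1]_x g x - \int[l2]_x g x| <= 2 * M * e.
Proof.
move=> mg gM; have M0 : 0 <= M by exact: le_trans (gM point).
have [M_eq0|Mneq0] := eqVneq M 0.
  have g0 x : g x = 0.
    by apply/eqP; rewrite -normr_le0 -M_eq0.
  rewrite (_ : g = cst 0); last exact/funext.
  by rewrite !Rintegral_cst// !mul0r subrr normr0 M_eq0 mulr0 mul0r.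
have {M0 Mneq0} M0 : 0 < M by rewrite lt_neqAle eq_sym Mneq0.
pose g' x := (2 * M)^-1 * g x + 2^-1.
have mg' : measurable_fun setT g'.
  by apply: measurable_funD => //; exact: measurable_funM.
have g'01 x : 0 <= g' x <= 1.
  have : `|(2 * M)^-1 * g x| <= 2^-1.
    rewrite normrM gtr0_norm ?invr_gt0 ?mulr_gt0// invfM -mulrA ger_pMr ?invr_gt0//.
    by rewrite mulrC ler_pdivrMr// mul1r.
  by rewrite ler_norml /g' => /andP[a b]; apply/andP; split; lra.
have bg' := bounded_measurable01 mg' g'01.
have dy : `|\int[l1]_x g' x - \int[l2]_x g' x| <= e.
  apply/ler_addgt0Pr => r r0.
  have [K Kr] : exists K, 2^-1 ^+ K <= r :> R.
    have h : (fun K => (2^-1 : R) ^+ K) @ \oo --> 0.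
      by apply: cvg_expr; rewrite ger0_norm ?invr_ge0// invf_lt1// ltr1n.
    move/cvgr0Pnorm_lt : h => /(_ _ r0)[K _ /(_ K (leqnn K))].
    by rewrite ger0_norm ?exprn_ge0 ?invr_ge0// => /ltW; exists K.
  by apply: le_trans (total_variation_dyadic K mg' g'01) _; rewrite lerD2l.
have ig (l : probability T R) : \int[l]_x g x = 2 * M * \int[l]_x g' x - M.
  have -> : M = \int[l]_x (cst M x).
    by rewrite Rintegral_cst//= [X in fine X](probability_setT l) mulr1.
  rewrite -{1}[\int[l]_x cst M x]/(\int[l]_x M).
  rewrite [X in 2 * X](_ : _ = M); last first.
    by rewrite Rintegral_cst//= [X in fine X](probability_setT l) mulr1.
  rewrite -RintegralZl//; last exact: bounded_measurable_integrable.
  rewrite -RintegralB//; last 2 first.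
  - apply: bounded_measurable_integrable.
    by apply: bounded_measurableM => //; exact: bounded_measurable_cst.
  - by apply: bounded_measurable_integrable; exact: bounded_measurable_cst.
  apply: eq_Rintegral => x _; rewrite /g' /cst/= mulrDr mulrA divff ?mulf_neq0 ?gt_eqF//.
  by lra.
rewrite !ig.
have -> : 2 * M * \int[l1]_x g' x - M - (2 * M * \int[l2]_x g' x - M) =
  2 * M * (\int[l1]_x g' x - \int[l2]_x g' x) by ring.
by rewrite normrM gtr0_norm ?mulr_gt0// ler_wpM2l// mulr_ge0// ltW.
Qed.

End total_variation.

Section countable_algebra.
Context (T : pointedType) (c : nat -> set T).

(* The algebra of the unions of atoms of [c 0, ..., c (k - 1)]. *)
Fixpoint atomic_algebra k : set (set T) :=
  match k with
  | 0 => [set A | A = set0 \/ A = setT]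
  | k'.+1 => [set (AB.1 `&` c k') `|` (AB.2 `\` c k') |
              AB in atomic_algebra k' `*` atomic_algebra k']
  end.

Lemma atomic_algebraS k : atomic_algebra k `<=` atomic_algebra k.+1.
Proof.
move=> A kA; exists (A, A) => //=.
by rewrite -[RHS](setUIDK A (c k)) setDE.
Qed.

Lemma atomic_algebra_le k l : (k <= l)%N -> atomic_algebra k `<=` atomic_algebra l.
Proof.
move=> /subnK <-; elim: (l - k)%N => // n IH A /IH.
by rewrite addSn; exact: atomic_algebraS.
Qed.

Lemma atomic_algebra_setring k : setring (atomic_algebra k).
Proof.
elim: k => [|k [I0 IU ID]]; split => /=.
- by left.
- by move=> A B /= [->|->] [->|->] /=; rewrite ?setU0 ?setUT ?set0U ?setTU; [left|right|right|right].
- by move=> A B /= [->|->] [->|->] /=; rewrite ?setD0 ?setDT ?set0D; [left|left|right|left].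
- by exists (set0, set0) => //=; rewrite set0I set0D setU0.
- move=> _ _ [[A B] [/= kA kB] <-] [[A' B'] [/= kA' kB'] <-].
  exists (A `|` A', B `|` B'); first by split; exact: IU.
  by apply/seteqP; split => x /=; tauto.
- move=> _ _ [[A B] [/= kA kB] <-] [[A' B'] [/= kA' kB'] <-].
  exists (A `\` A', B `\` B'); first by split; exact: ID.
  by apply/seteqP; split => x /=; tauto.
Qed.

(** The algebras attached to the first [k] sets are countable and increasing, so their union is a
    countable algebra, which is then listed as a sequence. *)
Lemma countable_algebra : exists a : nat -> set T,
  [/\ setring (range a), range a setT, forall i, range a (c i) &
      forall j, <<s range c >> (a j)].
Proof.
pose G := \bigcup_k atomic_algebra k.
have GT : G setT by exists 0%N => //=; right.
have cG : countable G.
  apply: bigcup_countable => // k _; elim: k => [|k IH] /=.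
    rewrite (_ : [set A | _] = [set set0; setT]); first exact/finite_set_countable.
    by apply/seteqP; split.
  exact: card_le_trans (card_image_le _ _) (countableX IH IH).
have /countable_injP[f injf] := cG.
(* The injection [f] is inverted; numbers outside its image are sent to [setT], which is in [G], so
   the range is exactly [G]. *)
pose a n := xget setT [set A | G A /\ f A = n].
have aG : range a = G.
  apply/seteqP; split=> [_ [n _ <-]|A GA].
    by rewrite /a; case: xgetP => [A -> []|].
  exists (f A) => //; rewrite /a; case: xgetP => [B -> [GB fBA]|/(_ A)]; last by case.
  by apply: injf => //; rewrite inE.
exists a; rewrite aG; split => //.
- split.
  + by exists 0%N => //; left.
  + move=> A B [k _ kA] [l _ lB]; exists (maxn k l) => //.
    have [_ U _] := atomic_algebra_setring (maxn k l).
    by apply: U; [exact: (atomic_algebra_le (leq_maxl k l))|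
                  exact: (atomic_algebra_le (leq_maxr k l))].
  + move=> A B [k _ kA] [l _ lB]; exists (maxn k l) => //.
    have [_ _ D] := atomic_algebra_setring (maxn k l).
    by apply: D; [exact: (atomic_algebra_le (leq_maxl k l))|
                  exact: (atomic_algebra_le (leq_maxr k l))].
- move=> i; exists i.+1 => //=; exists (setT, set0) => /=.
    by split; apply: (atomic_algebra_le (leq0n i)); [right|left].
  by rewrite setTI set0D setU0.
- move=> j; have [k _] : G (a j) by rewrite -aG; exists j.
  pose S := g_sigma_algebraType (range c).
  suff : atomic_algebra k `<=` <<s range c >> by exact.
  elim: k => [|k IH] A /=.
    by move=> [->|->]; [exact: (@measurable0 _ S)|exact: (@measurableT _ S)].
  have mc : <<s range c >> (c k) by apply: sub_sigma_algebra; exists k.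
  move=> [[B C] [/= /IH mB /IH mC] <-].
  by apply: (@measurableU _ S); [exact: (@measurableI _ S)|exact: (@measurableD _ S)].
Qed.

End countable_algebra.

(** * Finite observation sequences as a countably generated measurable space *)

HB.instance Definition _ (T : choiceType) := isPointed.Build (seq T) [::].

Lemma measurable_fun_generators d (T : measurableType d) (U : pointedType)
    (G : set (set U)) (D : set T) (f : T -> g_sigma_algebraType G) :
  (forall A, G A -> measurable (D `&` f @^-1` A)) -> measurable_fun D f.
Proof.
move=> h; apply: (@measurability _ _ T (g_sigma_algebraType G) D f G) => //.
by move=> _ [A GA <-]; exact: h.
Qed.

(** Interiors of balls of radius [1 / (k + 1)] around the points of a countable dense set form a
    base. *)
Lemma separable_countable_base (R : realType) (Y : completePseudoMetricType R) :
  (exists D : set Y, countable D /\ dense D) ->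
  exists V : nat * nat -> set Y, (forall i, open (V i)) /\
    forall U, open U -> forall x, U x -> exists i, V i x /\ V i `<=` U.
Proof.
move=> [D [/countable_injP[f injf] dD]].
(* The union runs over at most one centre, the point of [D] numbered [i.1], and is empty when there
   is none. *)
pose V (i : nat * nat) := \bigcup_(y in [set y | D y /\ f y = i.1])
  (ball y (i.2.+1%:R^-1 : R))°.
exists V; split=> [i|U oU x Ux].
  by apply: bigcup_open => y _; exact: open_interior.
have [e /= e0 xeU] : exists2 e : R, 0 < e & ball x e `<=` U.
  by apply/nbhs_ballP; rewrite nbhsE; exists U.
have e20 : 0 < e / 2 by rewrite divr_gt0.
(* For a radius [r < e / 2] and a centre [y] within [r / 2] of [x], the point [x] is interior to the
   [r]-ball around [y], which lies in the ball of radius [r / 2 + r <= e] around [x]. *)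
have [k _ /(_ k (leqnn k)) /= ke] := near_infty_natSinv_lt (PosNum e20).
have k0 : 0 < k.+1%:R^-1 :> R by rewrite invr_gt0.
have k20 : 0 < k.+1%:R^-1 / 2 :> R by rewrite divr_gt0.
have [y [xy Dy]] : (ball x (k.+1%:R^-1 / 2))° `&` D !=set0.
  apply: dD; last exact: open_interior.
  by exists x; exact: nbhsx_ballx.
have {}xy := interior_subset xy.
exists (f y, k); split.
  exists y => //; rewrite /interior; apply/nbhs_ballP; exists (k.+1%:R^-1 / 2) => // z xz.
  rewrite [X in ball _ X](splitr k.+1%:R^-1); apply: ball_triangle xz.
  exact: ball_sym.
move=> z [y' [/= Dy' ff]] /interior_subset.
have -> : y' = y by apply: injf; rewrite ?inE.
move=> yz; apply: xeU; apply: le_ball (ball_triangle xy yz).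
have h (r : R) : 0 < r -> r < e / 2 -> r / 2 + r <= e by move=> *; lra.
exact: h k0 ke.
Qed.

Section seq_space.
Context (R : realType) (Y : completePseudoMetricType R).
Variable V : nat * nat -> set Y.
Hypothesis oV : forall i, open (V i).
Hypothesis baseV : forall U, open U -> forall x, U x -> exists i, V i x /\ V i `<=` U.

(** One sequence of sets lists all lengths, positions and base sets, which keeps the sigma-algebra
    countably generated; codes that decode to nothing give the empty set. *)
Definition seq_cylinder (i : nat) : set (seq Y) :=
  if unpickle i is Some (n, j, k) then
    [set ys | size ys = n /\ V k (nth point ys j)]
  else set0.

Definition seq_space := g_sigma_algebraType (range seq_cylinder).

Lemma measurable_seq_cylinder n j k :
  measurable ([set ys | size ys = n /\ V k (nth point ys j)] : set seq_space).
Proof.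
apply: sub_sigma_algebra; exists (pickle (n, j, k)) => //.
by rewrite /seq_cylinder pickleK.
Qed.

Lemma measurable_nth_open n j U : open U ->
  measurable ([set ys | size ys = n /\ U (nth point ys j)] : set seq_space).
Proof.
move=> oU.
rewrite (_ : [set _ | _] = \bigcup_(k in [set k | V k `<=` U])
    [set ys | size ys = n /\ V k (nth point ys j)]); last first.
  apply/seteqP; split=> [ys [sn Uj]|ys [k /= kU [sn /kU]]] //.
  by have [k [Vk kU]] := baseV oU Uj; exists k.
rewrite bigcup_mkcond; apply: countable_bigcupT_measurable => [|k].
  exact: countableP.
by case: ifPn => // _; exact: measurable_seq_cylinder.
Qed.

Lemma measurable_size n : measurable ([set ys | size ys = n] : set seq_space).
Proof.
rewrite (_ : [set _ | _] = [set ys | size ys = n /\ setT (nth point ys 0%N)]).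
  by apply: measurable_nth_open; exact: openT.
by apply/seteqP; split => // ys [].
Qed.

Lemma measurable_nth_Borel n j (B : set (Borel Y)) : measurable B ->
  measurable ([set ys | size ys = n /\ B (nth point ys j)] : set seq_space).
Proof.
move=> mB.
have : measurable_fun ([set ys | size ys = n] : set seq_space)
    (fun ys => nth point ys j : Borel Y).
  apply: measurable_fun_generators => U oU.
  exact: measurable_nth_open.
by apply => //; exact: measurable_size.
Qed.

(** The test functions provided by observability are measurable for [cylN N]; this inclusion makes
    them usable on [seq_space]. *)
Lemma cylN_measurable N : <<s cylN N >> `<=` (measurable : set (set seq_space)).
Proof.
apply: smallest_sub; first exact: sigma_algebra_measurable.
move=> _ [B [mB ->]].
rewrite (_ : [set _ | _] = [set ys | size ys = N] `&`
   \bigcap_(i in `I_N) (~` [set ys | size ys = N] `|`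
     [set ys | size ys = N /\ B i (nth point ys i)])).
  apply: measurableI; first exact: measurable_size.
  apply: fin_bigcap_measurable => // i _; apply: measurableU.
    by apply: measurableC; exact: measurable_size.
  exact: measurable_nth_Borel.
apply/seteqP; split=> ys /= [sN h]; split => // i iN.
  by right; split => //; exact: h.
by have [|[]] := h i iN.
Qed.

(** A cylinder condition on the extended sequence concerns either the prefix, the appended entry, or
    a position beyond the end. *)
Lemma measurable_rcons :
  measurable_fun setT (fun p : seq_space * Borel Y => rcons p.1 p.2 : seq_space).
Proof.
apply: measurable_fun_generators => _ [i _ <-].
rewrite setTI /seq_cylinder; case: unpickle => [[[n j] k]|]; last first.
  by rewrite preimage_set0.
case: n => [|n].
  rewrite (_ : _ @^-1` _ = set0)// -subset0 => -[ys y] /= [].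
  by rewrite size_rcons.
have mS : measurable ([set ys | size ys = n] : set seq_space) by exact: measurable_size.
have [jn|nj] := ltnP j n.
  rewrite (_ : _ @^-1` _ = [set ys | size ys = n /\ V k (nth point ys j)] `*` setT).
    by apply: measurableX => //; exact: measurable_seq_cylinder.
  apply/seteqP; split=> -[ys y] /=.
    by rewrite size_rcons nth_rcons => -[[sn]]; rewrite sn jn.
  by move=> [[sn Vk] _]; rewrite size_rcons nth_rcons sn jn.
have [jn|jn] := eqVneq j n.
  rewrite (_ : _ @^-1` _ = [set ys | size ys = n] `*` V k).
    by apply: measurableX => //; exact: sub_sigma_algebra.
  apply/seteqP; split=> -[ys y] /=.
    by rewrite size_rcons nth_rcons => -[[sn]]; rewrite sn jn ltnn eqxx.
  by move=> [sn Vk]; rewrite size_rcons nth_rcons sn jn ltnn eqxx.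
(* Beyond the end [nth] returns [point], so the condition on the entry holds for all sequences or
   for none. *)
rewrite (_ : _ @^-1` _ = [set ys | size ys = n] `*` [set _ | V k point]).
  apply: measurableX => //.
  have [Vp|Vp] := pselect (V k point).
    by rewrite (_ : [set _ | _] = setT)//; apply/seteqP; split.
  by rewrite (_ : [set _ | _] = set0)//; apply/seteqP; split.
apply/seteqP; split=> -[ys y] /=.
  by rewrite size_rcons nth_rcons => -[[sn]]; rewrite sn ltnNge nj/= (negbTE jn).
by move=> [sn Vk]; rewrite size_rcons nth_rcons sn ltnNge nj/= (negbTE jn).
Qed.

(** [measurable_YN] constrains [g] on sequences of length [N] only; the value 0 at all other lengths
    gives a function measurable on the whole space. *)
Lemma measurable_YN_restrict N (g : seq Y -> R) : measurable_YN N g ->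
  measurable_fun setT (fun ys : seq_space => if size ys == N then g ys else 0).
Proof.
move=> mg _ U mU; rewrite setTI.
have mS : measurable ([set ys | size ys = N] : set seq_space) by exact: measurable_size.
rewrite (_ : _ @^-1` _ = [set ys | size ys = N /\ U (g ys)] `|`
  (~` [set ys | size ys = N] `&` [set _ | U 0])).
  apply: measurableU; first by apply: (@cylN_measurable N); exact: mg.
  apply: measurableI; first exact: measurableC.
  have [Vp|Vp] := pselect (U 0).
    by rewrite (_ : [set _ | _] = setT)//; apply/seteqP; split.
  by rewrite (_ : [set _ | _] = set0)//; apply/seteqP; split.
apply/seteqP; split=> ys /=; case: eqP => //=; tauto.
Qed.

End seq_space.

(** * The hidden Markov model *)

Section kernel_precomposition.
Context d1 d2 d3 (A : measurableType d1) (B : measurableType d2)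
  (C : measurableType d3) (R : realType).
Variables (k : R.-pker B ~> C) (f : A -> B) (mf : measurable_fun setT f).

Definition kernel_precomp of measurable_fun setT f :=
  fun a => k (f a) : {measure set C -> \bar R}.

Let kernel_precomp_measurable U : measurable U ->
  measurable_fun setT (kernel_precomp mf ^~ U).
Proof. by move=> mU; exact: (measurableT_comp (measurable_kernel k U mU)). Qed.

HB.instance Definition _ := isKernel.Build _ _ _ _ _
  (kernel_precomp mf) kernel_precomp_measurable.

Let kernel_precomp_prob x : kernel_precomp mf x setT = 1%E.
Proof. exact: prob_kernel. Qed.

HB.instance Definition _ := @Kernel_isProbability.Build _ _ _ _ R
  (kernel_precomp mf) kernel_precomp_prob.

End kernel_precomposition.

Section kernel_constant.
Context d1 d2 (A : measurableType d1) (B : measurableType d2) (R : realType).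
Variable P : probability B R.

Definition kernel_cst (_ : A) : {measure set B -> \bar R} := P.

Let kernel_cst_measurable U : measurable U -> measurable_fun setT (kernel_cst ^~ U).
Proof. by move=> mU; exact: measurable_cst. Qed.

HB.instance Definition _ := isKernel.Build _ _ _ _ _ kernel_cst kernel_cst_measurable.

Let kernel_cst_prob x : kernel_cst x setT = 1%E.
Proof. exact: probability_setT. Qed.

HB.instance Definition _ := @Kernel_isProbability.Build _ _ _ _ R
  kernel_cst kernel_cst_prob.

End kernel_constant.

Section kernel_probability.
Context d1 d2 (A : measurableType d1) (B : measurableType d2) (R : realType).
Variables (k : R.-pker A ~> B) (a : A).

Definition kernel_probability : set B -> \bar R := k a.

HB.instance Definition _ := Measure.copy kernel_probability (k a).

Let kernel_probability_setT : kernel_probability setT = 1%E.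
Proof. exact: prob_kernel. Qed.

HB.instance Definition _ := Measure_isProbability.Build _ _ _
  kernel_probability kernel_probability_setT.

End kernel_probability.

Section bounded_measurable_kernel.
Context d1 d2 (A : measurableType d1) (B : measurableType d2) (R : realType).
Variable k : R.-pker A ~> B.

Lemma bounded_measurable_kernel_integrable a (f : B -> R) :
  bounded_measurable f -> (k a).-integrable setT (EFin \o f).
Proof.
move=> [mf [M fM]]; apply: measurable_bounded_integrable => //.
  by rewrite prob_kernel ltry.
exists M; split; first exact: num_real.
by move=> N MN x _ /=; rewrite (le_trans (fM x))// ltW.
Qed.

Lemma EFin_Rintegral_kernel a (f : B -> R) : bounded_measurable f ->
  (\int[k a]_x f x)%:E = (\int[k a]_x (f x)%:E)%E.
Proof.
move=> bf; rewrite /Rintegral fineK// integrable_fin_num//.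
exact: bounded_measurable_kernel_integrable.
Qed.

Lemma Rintegral_kernelD a (f : B -> R) c : bounded_measurable f ->
  \int[k a]_x (f x + c) = \int[k a]_x f x + c.
Proof.
move=> bf; rewrite RintegralD//; last 2 first.
- exact: bounded_measurable_kernel_integrable.
- by apply: bounded_measurable_kernel_integrable; exact: bounded_measurable_cst.
by rewrite Rintegral_cst// prob_kernel mulr1.
Qed.

Lemma le_Rintegral_kernel a (f : B -> R) M : bounded_measurable f ->
  (forall x, `|f x| <= M) -> `|\int[k a]_x f x| <= M.
Proof.
move=> bf fM; have ibf := bounded_measurable_kernel_integrable a bf.
apply: le_trans (le_normr_Rintegral measurableT ibf) _.
have -> : M = \int[k a]_x (cst M x) by rewrite Rintegral_cst// prob_kernel mulr1.
apply: le_Rintegral => //.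
- exact: integrable_norm.
- by apply: bounded_measurable_kernel_integrable; exact: bounded_measurable_cst.
Qed.

Lemma bounded_measurable_kernel (f : B -> R) : bounded_measurable f ->
  bounded_measurable (fun a => \int[k a]_x f x).
Proof.
move=> bf; have [mf [M fM]] := bf.
split; last by exists M => a; exact: le_Rintegral_kernel.
have bfM : bounded_measurable (fun x => f x + M).
  by apply: bounded_measurableD => //; exact: bounded_measurable_cst.
have fM0 x : 0 <= f x + M.
  by have := fM x; rewrite ler_norml => /andP[+ _]; rewrite -subr_ge0 opprK.
rewrite (_ : (fun a => _) = fun a => fine (\int[k a]_x (f x + M)%:E)%E - M).
  apply: measurable_funB => //; apply: measurableT_comp => //.
  apply: measurable_fun_integral_kernel => //.
  - by move=> U mU; exact: measurable_kernel.
  - by apply/measurable_EFinP; case: bfM.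
by apply/funext => a; rewrite -[fine _]/(\int[k a]_x (f x + M)) Rintegral_kernelD// addrK.
Qed.

End bounded_measurable_kernel.

Section probability_kernel_composition.
Context d1 d2 d3 (A : measurableType d1) (B : measurableType d2)
  (C : measurableType d3) (R : realType).
Variables (l : R.-pker A ~> B) (k : R.-pker (A * B) ~> C).
Local Open Scope ereal_scope.

Definition kernel_bind a : {measure set C -> \bar R} := (l \; k) a.

Let kernel_bind_measurable U : measurable U -> measurable_fun setT (kernel_bind ^~ U).
Proof. by move=> mU; exact: measurable_kernel. Qed.

HB.instance Definition _ := isKernel.Build _ _ _ _ _ kernel_bind kernel_bind_measurable.

Let kernel_bind_prob a : kernel_bind a setT = 1.
Proof.
rewrite /kernel_bind/= /kcomp.
under eq_integral do rewrite prob_kernel.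
by rewrite integral_cst// mul1e prob_kernel.
Qed.

HB.instance Definition _ := @Kernel_isProbability.Build _ _ _ _ R
  kernel_bind kernel_bind_prob.

Lemma integral_kernel_bind a (f : C -> \bar R) :
  measurable_fun setT f -> (forall x, 0 <= f x) ->
  \int[kernel_bind a]_x f x = \int[l a]_y \int[k (a, y)]_x f x.
Proof. by move=> mf f0; exact: (integral_kcomp l k a f0 mf). Qed.

Lemma Rintegral_kernel_bind a (f : C -> R) : bounded_measurable f ->
  (\int[kernel_bind a]_x f x = \int[l a]_y \int[k (a, y)]_x f x)%R.
Proof.
move=> bf; have [mf [M fM]] := bf.
have bka : bounded_measurable (fun y => \int[k (a, y)]_x f x)%R.
  have [mk [N kN]] := bounded_measurable_kernel k bf.
  split; last by exists N => y; exact: kN.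
  exact: (measurable_fun_pair2 a mk).
have bfM : bounded_measurable (fun x => f x + M)%R.
  by apply: bounded_measurableD => //; exact: bounded_measurable_cst.
have fM0 x : (0 <= f x + M)%R.
  by have := fM x; rewrite ler_norml => /andP[+ _]; rewrite -subr_ge0 opprK.
(* Adding the bound [M] makes the integrand nonnegative, where the identity for extended-valued
   integrals applies. *)
apply: (@addIr _ M).
rewrite -!Rintegral_kernelD//.
rewrite /Rintegral integral_kernel_bind//; last by apply/measurable_EFinP; case: bfM.
congr fine; apply: eq_integral => y _.
by rewrite -[fine _]/(\int[k (a, y)]_x f x)%R -Rintegral_kernelD// EFin_Rintegral_kernel.
Qed.

End probability_kernel_composition.

(** * The law of future observations given the current state *)

Section observation_kernel.
Context (R : realType) (X Y Z : completePseudoMetricType R).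
Variables (T : R.-pker (Borel X) ~> (Borel X)) (Q : probability (Borel Z) R).
Variable h : X -> Z -> Y.
Hypothesis mh : measurable_fun [set: Borel X * Borel Z]
  (fun p : Borel X * Borel Z => (h p.1 p.2 : Borel Y)).
Variable V : nat * nat -> set Y.
Hypothesis oV : forall i, open (V i).
Hypothesis baseV : forall U, open U -> forall x, U x -> exists i, V i x /\ V i `<=` U.
Local Notation S := (seq_space V).

(** The argument lists the observed prefix, the current state, its noise and the next state. *)
Definition observation_update (p : (S * Borel X * Borel Z) * Borel X) : S * Borel X :=
  (rcons p.1.1.1 (h p.1.1.2 p.1.2), p.2).

Lemma measurable_observation_update : measurable_fun setT observation_update.
Proof.
have m3 : measurable_fun setT (fun p : (S * Borel X * Borel Z) * Borel X => p.1.1.2).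
  exact: (measurableT_comp measurable_snd (measurableT_comp measurable_fst measurable_fst)).
have m2 : measurable_fun setT
    (fun p : (S * Borel X * Borel Z) * Borel X => h p.1.1.2 p.1.2 : Borel Y).
  have m4 : measurable_fun setT (fun p : (S * Borel X * Borel Z) * Borel X => p.1.2).
    exact: (measurableT_comp measurable_snd measurable_fst).
  exact: (measurableT_comp mh (measurable_fun_pair m3 m4)).
have m1 : measurable_fun setT (fun p : (S * Borel X * Borel Z) * Borel X => p.1.1.1).
  exact: (measurableT_comp measurable_fst (measurableT_comp measurable_fst measurable_fst)).
have m0 : measurable_fun setT (fun p : (S * Borel X * Borel Z) * Borel X =>
    rcons p.1.1.1 (h p.1.1.2 p.1.2) : S).
  exact: (measurableT_comp (measurable_rcons oV baseV) (measurable_fun_pair m1 m2)).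
exact: (measurable_fun_pair m0 measurable_snd).
Qed.

Lemma measurable_current_state : measurable_fun setT (fun p : S * Borel X * Borel Z => p.1.2).
Proof. exact: measurableT_comp. Qed.

Section step.
Variable K : R.-pker (S * Borel X)%type ~> S.

Let move_kernel : R.-pker (S * Borel X * Borel Z)%type ~> Borel X :=
  kernel_precomp T measurable_current_state.

Let tail_kernel : R.-pker ((S * Borel X * Borel Z) * Borel X)%type ~> S :=
  kernel_precomp K measurable_observation_update.

Let noise_kernel : R.-pker (S * Borel X)%type ~> Borel Z := kernel_cst Q.

Let after_noise : R.-pker (S * Borel X * Borel Z)%type ~> S := 
  kernel_bind move_kernel tail_kernel.

Definition observation_step : R.-pker (S * Borel X)%type ~> S :=
  kernel_bind noise_kernel after_noise.

Lemma Rintegral_observation_step ys x (g : S -> R) : bounded_measurable g ->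
  \int[observation_step (ys, x)]_y g y =
  \int[Q]_z \int[T x]_x' \int[K (rcons ys (h x z), x')]_y g y.
Proof.
move=> bg; rewrite /observation_step Rintegral_kernel_bind//.
by apply: eq_Rintegral => z _; rewrite Rintegral_kernel_bind.
Qed.

End step.

(** The recursion of [obs_int] is an iterated integral, starting from the Dirac mass at the prefix
    and composing at each step with the noise and the transition. One kernel therefore serves all
    [g], and it yields a genuine conditional law. *)
Lemma observation_kernel m : exists K : R.-pker (S * Borel X)%type ~> S,
  forall g : S -> R, bounded_measurable g ->
  forall ys x, obs_int T Q h g m ys x = (\int[K (ys, x)]_y g y)%:E.
Proof.
elim: m => [|m [K IH]].
  exists (kdirac (@measurable_fst _ _ S (Borel X))) => g [mg _] ys x.
  rewrite /Rintegral integral_dirac//; last exact/measurable_EFinP.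
  by rewrite diracT mul1e.
exists (observation_step K) => g bg ys x.
rewrite Rintegral_observation_step//.
pose move_kernel : R.-pker (S * Borel X * Borel Z)%type ~> Borel X :=
  kernel_precomp T measurable_current_state.
pose tail_kernel : R.-pker ((S * Borel X * Borel Z) * Borel X)%type ~> S :=
  kernel_precomp K measurable_observation_update.
have b1 (w : S * Borel X * Borel Z) :
    bounded_measurable (fun x' => \int[K (rcons w.1.1 (h w.1.2 w.2), x')]_y g y).
  have [mk [M kM]] := bounded_measurable_kernel tail_kernel bg.
  by split; [exact: (measurable_fun_pair2 w mk)|exists M => x'; exact: (kM (w, x'))].
have b2 (w : S * Borel X) : bounded_measurable (fun z : Borel Z =>
    \int[T w.2]_x' \int[K (rcons w.1 (h w.2 z), x')]_y g y).
  have [mk [M kM]] := bounded_measurable_kernel (kernel_bind move_kernel tail_kernel) bg.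
  have e (z : Borel Z) : \int[T w.2]_x' \int[K (rcons w.1 (h w.2 z), x')]_y g y =
      \int[kernel_bind move_kernel tail_kernel (w, z)]_y g y.
    by rewrite Rintegral_kernel_bind.
  split; last by exists M => z; rewrite e; exact: kM.
  by under eq_fun do rewrite e; exact: (measurable_fun_pair2 w mk).
transitivity (\int[Q]_z \int[T x]_x' obs_int T Q h g m (rcons ys (h x z)) x')%E.
  by [].
rewrite EFin_Rintegral; last exact: (b2 (ys, x)).
apply: eq_integral => z _.
rewrite EFin_Rintegral_kernel; last exact: (b1 (ys, x, z)).
by apply: eq_integral => x' _; exact: IH.
Qed.

End observation_kernel.

Section bounded_conditional_kernel.
Context d1 d2 (U : measurableType d1) (V : measurableType d2) (R : realType).
Context d0 (T : measurableType d0) (P : probability T R).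
Variables (u : T -> U) (v : T -> V) (k : R.-pker U ~> V).
Hypotheses (mu : measurable_fun setT u) (mv : measurable_fun setT v).

Lemma Rintegral_conditional_kernel :
  (forall E C, measurable E -> measurable C ->
    P (u @^-1` E `&` v @^-1` C) = (\int[P]_(w in u @^-1` E) k (u w) C)%E) ->
  forall f : U * V -> R, bounded_measurable f ->
    \int[P]_w f (u w, v w) = \int[P]_w \int[k (u w)]_y f (u w, y).
Proof.
move=> PE f bf; have [mf [M fM]] := bf.
have bx x : bounded_measurable (fun y => f (x, y)).
  by split; [exact: measurable_fun_pair2|exists M => y; exact: fM].
have fM0 x : 0 <= f x + M.
  by have := fM x; rewrite ler_norml => /andP[+ _]; rewrite -subr_ge0 opprK.
have mfM : measurable_fun setT (fun x => (f x + M)%:E).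
  by apply/measurable_EFinP; exact: measurable_funD.
have muv : measurable_fun setT (fun w => (u w, v w)) by exact: measurable_fun_pair.
have bfuv : bounded_measurable (fun w => f (u w, v w)).
  by split; [exact: (measurableT_comp mf muv)|exists M => w; exact: fM].
have mk : measurable_fun setT (fun x => \int[k x]_y (f (x, y) + M)).
  have fM0' x : (0 <= (f x + M)%:E)%E by rewrite lee_fin.
  apply: measurableT_comp => //; exact: (measurable_kernel_integral k mfM fM0').
have bk : bounded_measurable (fun w => \int[k (u w)]_y f (u w, y)).
  split; last by exists M => w; apply: le_Rintegral_kernel => // y; exact: fM.
  rewrite (_ : (fun w => _) = (fun w => \int[k (u w)]_y (f (u w, y) + M) - M)).
    by apply: measurable_funB => //; exact: (measurableT_comp mk mu).
  by apply/funext => w; rewrite Rintegral_kernelD// addrK.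
have PD (a : T -> R) : bounded_measurable a -> \int[P]_w (a w + M) = \int[P]_w a w + M.
  move=> ba; rewrite RintegralD//; last 2 first.
  - exact: bounded_measurable_integrable.
  - by apply: bounded_measurable_integrable; exact: bounded_measurable_cst.
  by rewrite Rintegral_cst//= [X in fine X](probability_setT P) mulr1.
apply: (@addIr _ M); rewrite -!PD//.
have := @integral_conditional_kernel _ _ _ _ R _ T P _ measurableT _ _ mu mv k _ _ mfM.
rewrite /Rintegral => ->.
- congr fine; apply: eq_integral => w _.
  rewrite -[fine _]/(\int[k (u w)]_y f (u w, y)) -Rintegral_kernelD//.
  rewrite EFin_Rintegral_kernel//.
  by apply: bounded_measurableD => //; exact: bounded_measurable_cst.
- by move=> E C mE mC; rewrite !setTI; exact: PE.
- by move=> x; rewrite lee_fin.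
Qed.

End bounded_conditional_kernel.

Section density.
Context d (T : measurableType d) (R : realType).
Local Open Scope ereal_scope.

Section density_measure.
Variables (m : {measure set T -> \bar R}) (f : T -> \bar R).
Hypotheses (mf : measurable_fun setT f) (f0 : forall x, 0 <= f x).

Definition density_measure of measurable_fun setT f & (forall x, 0 <= f x) :=
  fun A : set T => \int[m]_(x in A) f x.

Let density0 : density_measure mf f0 set0 = 0.
Proof. exact: integral_set0. Qed.

Let density_ge0 A : 0 <= density_measure mf f0 A.
Proof. by apply: integral_ge0 => x _. Qed.

Let density_sigma_additive : semi_sigma_additive (density_measure mf f0).
Proof. exact: semi_sigma_additive_nng_induced. Qed.

HB.instance Definition _ := isMeasure.Build _ _ _ (density_measure mf f0)
  density0 density_ge0 density_sigma_additive.

End density_measure.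

(** Both sides are measures in [A], finite on the left, so their equality extends from the pi-system
    [G] to the sigma-algebra that it generates. *)
Lemma density_sigma_algebra (m : {finite_measure set T -> \bar R}) (G : set (set T))
    (E : set T) (f : T -> \bar R) :
  G `<=` measurable -> setI_closed G -> G setT -> measurable E ->
  measurable_fun setT f -> (forall x, 0 <= f x) ->
  (forall A, G A -> m (A `&` E) = \int[m]_(x in A) f x) ->
  forall A, <<s G >> A -> m (A `&` E) = \int[m]_(x in A) f x.
Proof.
move=> Gm GI GT mE mf f0 GE A sA.
have := @g_sigma_algebra_measure_unique _ R T G Gm (fun=> setT) (fun=> GT)
  (bigcup_const _ _) (mrestr m mE) (density_measure m mf f0) GI GE _ A sA.
apply; [by exists 0%N|move=> _; rewrite ltey_eq fin_num_measure//].
Qed.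

Lemma ge0_integral_density (l m : {finite_measure set T -> \bar R}) f g :
  measurable_fun setT f -> (forall x, 0 <= f x) ->
  measurable_fun setT g -> (forall x, 0 <= g x) ->
  (forall A, measurable A -> l A = \int[m]_(x in A) f x) ->
  \int[l]_x g x = \int[m]_x (g x * f x).
Proof.
move=> mf f0 mg g0 lm.
have l_m : l `<< m.
  apply/null_content_dominatesP => A mA mA0; rewrite lm//.
  by apply: null_set_integral => //; exact: measurable_funTS.
rewrite -(Radon_Nikodym_SigmaFinite.change_of_variables l_m)//.
have iRN := Radon_Nikodym_SigmaFinite.f_integrable l_m.
have mRN := measurable_int _ iRN.
apply: ae_eq_integral => //; [exact: emeasurable_funM..|].
apply: ae_eqe_mul2l; apply: integral_ae_eq => //.
by move=> A _ mA; rewrite -Radon_Nikodym_SigmaFinite.f_integral// lm.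
Qed.

End density.

(** * Markov property, independence of the noise and absolute continuity on trajectories *)

Section hidden_markov_model.
Context (R : realType) (X Z : completePseudoMetricType R).
Variables (T : R.-pker (Borel X) ~> (Borel X)) (Q : probability (Borel Z) R).
Context (dO : measure_display) (O : measurableType dO).
Variables (Xs : nat -> O -> Borel X) (Zs : nat -> O -> Borel Z).
Hypothesis mXs : forall n, measurable_fun [set: O] (Xs n).
Hypothesis mZs : forall n, measurable_fun [set: O] (Zs n).
Implicit Types (A : nat -> set (Borel X)) (B : nat -> set (Borel Z)).
Local Open Scope ereal_scope.

Lemma chain_int_ge0 A i k x : 0 <= chain_int T A i k x.
Proof.
elim: k i x => [|k IH] i x /=; first by rewrite lee_fin.
by rewrite mule_ge0// ?lee_fin//; apply: integral_ge0 => y _.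
Qed.

Lemma measurable_chain_int A i k : (forall j, measurable (A j)) ->
  measurable_fun setT (chain_int T A i k).
Proof.
move=> mA; elim: k i => [|k IH] i /=.
  by apply/measurable_EFinP; exact: measurable_indic.
apply: emeasurable_funM; first by apply/measurable_EFinP; exact: measurable_indic.
apply: measurable_fun_integral_kernel => //.
- by move=> U mU; exact: measurable_kernel.
- by move=> y; exact: chain_int_ge0.
Qed.

Lemma chain_int_out A i k x : ~ A i x -> chain_int T A i k x = 0.
Proof.
move=> Ax; case: k => [|k] /=; rewrite indicE memNset// ?mul0e//.
Qed.

Lemma eq_chain_int A A' i k x : (forall j, (i <= j)%N -> (j <= i + k)%N -> A j = A' j) ->
  chain_int T A i k x = chain_int T A' i k x.
Proof.
elim: k i x => [|k IH] i x AA' /=; first by rewrite AA'// addn0.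
rewrite AA'// ?leq_addr//; congr (_ * _); apply: eq_integral => y _; apply: IH => j ij jk.
by apply: AA'; [exact: ltnW|rewrite -addSnnS].
Qed.

(** These are the events whose probability [pomp_law] prescribes; index [n] constrains only the
    times strictly before [n]. *)
Definition rectangle n A B : set O :=
  \bigcap_(i in `I_n) (Xs i @^-1` A i `&` Zs i @^-1` B i).

Let mX n C : measurable C -> measurable (Xs n @^-1` C).
Proof. by move=> mC; rewrite -[X in measurable X]setTI; exact: mXs. Qed.

Let mZ n C : measurable C -> measurable (Zs n @^-1` C).
Proof. by move=> mC; rewrite -[X in measurable X]setTI; exact: mZs. Qed.

Lemma measurable_rectangle n A B :
  (forall i, measurable (A i)) -> (forall i, measurable (B i)) ->
  measurable (rectangle n A B).
Proof.
move=> mA mB; apply: fin_bigcap_measurable => // i _.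
by apply: measurableI; [exact: mX|exact: mZ].
Qed.

Lemma rectangleS n A B :
  rectangle n.+1 A B = rectangle n A B `&` (Xs n @^-1` A n `&` Zs n @^-1` B n).
Proof.
apply/seteqP; split=> w.
  move=> h; split; last exact: h n (ltnSn n).
  by move=> i /= ilt; apply: h; exact: ltnW.
move=> [h hn] i /=; rewrite ltnS leq_eqVlt => /predU1P[->//|].
exact: h.
Qed.

Lemma eq_rectangle n A A' B B' : (forall i, (i < n)%N -> A i = A' i) ->
  (forall i, (i < n)%N -> B i = B' i) -> rectangle n A B = rectangle n A' B'.
Proof.
by move=> AA' BB'; apply: eq_bigcapr => i /= ilt; rewrite AA'// BB'.
Qed.

Definition set_at (U : Type) (F : nat -> set U) n C := fun i => if i == n then C else F i.

Lemma set_atE (U : Type) (F : nat -> set U) n C : set_at F n C n = C.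
Proof. by rewrite /set_at eqxx. Qed.

Lemma measurable_set_at d (U : measurableType d) (F : nat -> set U) n C :
  (forall i, measurable (F i)) -> measurable C -> forall i, measurable (set_at F n C i).
Proof. by move=> mF mC i; rewrite /set_at; case: ifP. Qed.

Lemma rectangle_set_at n A B C E :
  rectangle n.+1 (set_at A n C) (set_at B n E) =
  rectangle n A B `&` (Xs n @^-1` C `&` Zs n @^-1` E).
Proof.
rewrite rectangleS !set_atE; congr (_ `&` _).
by apply: eq_rectangle => i ilt; rewrite /set_at ltn_eqF.
Qed.

Section law.
Variables (m : probability (Borel X) R) (P : probability O R).
Hypothesis law : pomp_law T Q m P Xs Zs.

Let rectangle_law n A B :
  (forall i, measurable (A i)) -> (forall i, measurable (B i)) ->
  P (rectangle n.+1 A B) = \prod_(0 <= i < n.+1) Q (B i) * \int[m]_x chain_int T A 0 n x.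
Proof. by move=> mA mB; rewrite big_mkord; exact: law. Qed.

(** In the product formula the set [E] contributes only the factor [Q E]; the comparison is with [E]
    replaced by the whole space, whose factor is 1. *)
Lemma noise_independent n A B C E :
  (forall i, measurable (A i)) -> (forall i, measurable (B i)) ->
  measurable C -> measurable E ->
  P (rectangle n A B `&` Xs n @^-1` C `&` Zs n @^-1` E) =
  Q E * P (rectangle n A B `&` Xs n @^-1` C).
Proof.
move=> mA mB mC mE.
have h E' : measurable E' -> P (rectangle n A B `&` Xs n @^-1` C `&` Zs n @^-1` E') =
    \prod_(0 <= i < n) Q (B i) * Q E' * \int[m]_x chain_int T (set_at A n C) 0 n x.
  move=> mE'; rewrite -setIA -rectangle_set_at rectangle_law; last 2 first.
  - exact: measurable_set_at.
  - exact: measurable_set_at.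
  rewrite big_nat_recr//= set_atE; congr (_ * _ * _).
  apply: eq_big_nat => i /andP[_ ilt]; by rewrite /set_at ltn_eqF.
by rewrite -[X in Q E * P X]setIT -(preimage_setT (Zs n)) !h// probability_setT
  mule1 muleA [Q E * _]muleC.
Qed.

(** The kernel constantly equal to [Q] is the conditional law of the noise given the state on the
    rectangle. *)
Lemma integral_noise_independent n A B E (f : Borel X -> \bar R) :
  (forall i, measurable (A i)) -> (forall i, measurable (B i)) -> measurable E ->
  measurable_fun setT f -> (forall x, 0 <= f x) ->
  \int[P]_(w in rectangle n A B `&` Zs n @^-1` E) f (Xs n w) =
  Q E * \int[P]_(w in rectangle n A B) f (Xs n w).
Proof.
move=> mA mB mE mf f0.
have mR := measurable_rectangle n mA mB.
pose F (p : Borel X * Borel Z) := f p.1 * (\1_E p.2)%:E.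
have F0 p : 0 <= F p by rewrite mule_ge0// lee_fin.
have mF : measurable_fun setT F.
  apply: emeasurable_funM; first exact: measurableT_comp.
  by apply/measurable_EFinP; apply: measurableT_comp => //; exact: measurable_indic.
have mfX : measurable_fun setT (fun w => f (Xs n w)) by exact: measurableT_comp.
pose kQ : R.-pker (Borel X) ~> (Borel Z) := kernel_cst Q.
have := @integral_conditional_kernel _ _ _ _ R _ O P _ mR _ _ (mXs n) (mZs n)
  kQ _ F mF F0.
rewrite /F/= => h.
transitivity (\int[P]_(w in rectangle n A B) (f (Xs n w) * (\1_E (Zs n w))%:E)).
  rewrite integral_mkcondr; apply: eq_integral => w _.
  rewrite patchE indicE (_ : (Zs n w \in E) = (w \in Zs n @^-1` E)).
    by case: ifPn => wE; rewrite ?mule1 ?mule0.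
  by apply/idP/idP; rewrite !inE.
rewrite h; last first.
  move=> C E' mC mE'; rewrite noise_independent// integral_cst//.
  by apply: measurableI => //; exact: mX.
rewrite -ge0_integralZl//; last exact: measurable_funTS.
apply: eq_integral => w _; rewrite ge0_integralZl//; last first.
  by apply/measurable_EFinP; exact: measurable_indic.
by rewrite integral_indic// setIT muleC.
Qed.

Lemma integral_rectangleS n A B (f : Borel X -> \bar R) :
  (forall i, measurable (A i)) -> (forall i, measurable (B i)) ->
  measurable_fun setT f -> (forall x, 0 <= f x) -> (forall x, ~ A n x -> f x = 0) ->
  \int[P]_(w in rectangle n.+1 A B) f (Xs n w) =
  Q (B n) * \int[P]_(w in rectangle n A B) f (Xs n w).
Proof.
move=> mA mB mf f0 fA; rewrite -integral_noise_independent//.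
rewrite rectangleS [Xs n @^-1` _ `&` _]setIC setIA integral_mkcondr.
apply: eq_integral => w _; rewrite patchE.
by case: ifPn => //; rewrite notin_setE => /fA.
Qed.

(** The chain formula with one further step, the last state in [C] and the last noise unconstrained,
    is the Markov property on rectangles. *)
Let markov_of_chain_law n :
  (forall A B, (forall i, measurable (A i)) -> (forall i, measurable (B i)) ->
    P (rectangle (n + 1).+1 A B) = \prod_(n.+1 <= i < (n + 1).+1) Q (B i) *
    \int[P]_(w in rectangle n.+1 A B) chain_int T A n 1 (Xs n w)) ->
  forall A B C, (forall i, measurable (A i)) -> (forall i, measurable (B i)) ->
    measurable C -> P (rectangle n.+1 A B `&` Xs n.+1 @^-1` C) =
    \int[P]_(w in rectangle n.+1 A B) T (Xs n w) C.
Proof.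
move=> IH A B C mA mB mC; have := IH (set_at A n.+1 C) (set_at B n.+1 setT).
rewrite addn1 rectangle_set_at preimage_setT setIT big_nat1 set_atE probability_setT mul1e.
move=> ->; last 2 first.
- exact: measurable_set_at.
- exact: measurable_set_at.
rewrite (@eq_rectangle n.+1 _ A _ B); last 2 first.
- by move=> i ilt; rewrite /set_at ltn_eqF.
- by move=> i ilt; rewrite /set_at ltn_eqF.
apply: eq_integral => w; rewrite inE rectangleS => -[_ [/= An _]].
rewrite set_atE {1}/set_at ltn_eqF// indicE mem_set// mul1e.
by rewrite integral_indic// setIT.
Qed.

(** Induction on [n]. The law itself gives the case 0; the formula at [n] with one further step
    gives the Markov property at [n], which turns the first transition of the chain integral from
    [Xs n] into an evaluation at [Xs n.+1]. *)
Let chain_law n k A B :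
  (forall i, measurable (A i)) -> (forall i, measurable (B i)) ->
  P (rectangle (n + k).+1 A B) = \prod_(n.+1 <= i < (n + k).+1) Q (B i) *
    \int[P]_(w in rectangle n.+1 A B) chain_int T A n k (Xs n w).
Proof.
elim: n k A B => [|n IH] k A B mA mB.
  rewrite integral_rectangleS//; last 3 first.
  - exact: measurable_chain_int.
  - by move=> x; exact: chain_int_ge0.
  - by move=> x; exact: chain_int_out.
  have -> : rectangle 0 A B = setT by rewrite /rectangle II0 bigcap_set0.
  rewrite add0n rectangle_law// big_nat_recl//= muleA [_ * Q _]muleC.
  rewrite big_add1/=; congr (_ * _).
  have mc := measurable_chain_int 0 k mA.
  transitivity (\int[image_measure P (mXs 0%N)]_x chain_int T A 0 k x); last first.
    rewrite ge0_integral_image ?preimage_setT// => x; exact: chain_int_ge0.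
  apply: eq_measure_integral => C mC _.
  have := @rectangle_law 0 (fun=> C) (fun=> setT) (fun=> mC) (fun=> measurableT).
  rewrite big_nat1 probability_setT mul1e /= integral_indic// setIT => <-.
  by rewrite rectangleS /rectangle II0 bigcap_set0 setTI preimage_setT setIT.
have markov := markov_of_chain_law (fun A B => IH 1%N A B).
have mR := measurable_rectangle n.+1 mA mB.
have mc := measurable_chain_int n.+1 k mA.
rewrite integral_rectangleS//; last 2 first.
- by move=> x; exact: chain_int_ge0.
- by move=> x; exact: chain_int_out.
have -> : \int[P]_(w in rectangle n.+1 A B) chain_int T A n.+1 k (Xs n.+1 w) =
    \int[P]_(w in rectangle n.+1 A B) chain_int T A n k.+1 (Xs n w).
  rewrite (@integral_conditional_kernel _ _ _ _ R _ O P _ mR _ _ (mXs n) (mXs n.+1)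
    T _ (fun p => chain_int T A n.+1 k p.2)).
  - apply: eq_integral => w; rewrite inE rectangleS => -[_ [/= An _]].
    by rewrite indicE mem_set// mul1e.
  - move=> E C mE mC.
    (* Constraining the state at time [n] further keeps the event a rectangle, so the Markov
       property applies to it. *)
    have -> : rectangle n.+1 A B `&` Xs n @^-1` E = rectangle n.+1 (set_at A n (A n `&` E)) B.
      rewrite !rectangleS set_atE preimage_setI.
      rewrite (@eq_rectangle n _ (set_at A n (A n `&` E)) _ B)//; last first.
        by move=> i ilt; rewrite /set_at ltn_eqF.
      by apply/seteqP; split => w /=; tauto.
    by apply: markov => //; apply: measurable_set_at => //; exact: measurableI.
  - exact: measurableT_comp.
  - by move=> p; exact: chain_int_ge0.
rewrite addSnnS IH// big_ltn; last by rewrite ltnS addnS ltnS leq_addr.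
by rewrite [in RHS]muleA [in RHS](muleC _ (Q _)).
Qed.

Lemma rectangle_markov n A B C :
  (forall i, measurable (A i)) -> (forall i, measurable (B i)) -> measurable C ->
  P (rectangle n.+1 A B `&` Xs n.+1 @^-1` C) =
  \int[P]_(w in rectangle n.+1 A B) T (Xs n w) C.
Proof. by apply: markov_of_chain_law => A' B'; exact: chain_law. Qed.

End law.

Definition past_generators n : set (set O) :=
  [set D | exists A B, [/\ forall i, measurable (A i), forall i, measurable (B i) &
    D = rectangle n A B]].

(** To the past before [n] this adds the state at time [n] but not its noise: it is the information
    available when [Zs n] is drawn. *)
Definition state_generators n : set (set O) :=
  [set D | exists A B C, [/\ forall i, measurable (A i), forall i, measurable (B i),
    measurable C & D = rectangle n A B `&` Xs n @^-1` C]].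

Lemma past_generators_measurable n : past_generators n `<=` measurable.
Proof. by move=> _ [A [B [mA mB ->]]]; exact: measurable_rectangle. Qed.

Lemma state_generators_measurable n : state_generators n `<=` measurable.
Proof.
move=> _ [A [B [C [mA mB mC ->]]]]; apply: measurableI; last exact: mX.
exact: measurable_rectangle.
Qed.

Lemma rectangleT n : rectangle n (fun=> setT) (fun=> setT) = setT.
Proof. by apply/seteqP; split. Qed.

Lemma rectangleI n A A' B B' : rectangle n A B `&` rectangle n A' B' =
  rectangle n (fun i => A i `&` A' i) (fun i => B i `&` B' i).
Proof.
apply/seteqP; split=> w.
  by move=> [h h'] i ilt; have [? ?] := h i ilt; have [? ?] := h' i ilt.
by move=> h; split=> i ilt; have [[? ?] [? ?]] := h i ilt.
Qed.

Lemma past_generatorsI n : setI_closed (past_generators n).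
Proof.
move=> _ _ [A [B [mA mB ->]]] [A' [B' [mA' mB' ->]]]; rewrite rectangleI.
by eexists _, _; split; last reflexivity; move=> i; exact: measurableI.
Qed.

Lemma past_generatorsT n : past_generators n setT.
Proof.
exists (fun=> setT), (fun=> setT); split; [by move=> i|by move=> i|].
by rewrite rectangleT.
Qed.

Lemma state_generatorsI n : setI_closed (state_generators n).
Proof.
move=> _ _ [A [B [C [mA mB mC ->]]]] [A' [B' [C' [mA' mB' mC' ->]]]].
rewrite setIACA rectangleI -preimage_setI.
eexists _, _, _; split; last reflexivity.
- by move=> i; exact: measurableI.
- by move=> i; exact: measurableI.
- exact: measurableI.
Qed.

Lemma state_generatorsT n : state_generators n setT.
Proof.
exists (fun=> setT), (fun=> setT), setT; split=> //.
by rewrite rectangleT preimage_setT setIT.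
Qed.

Lemma past_generators_le m n : (m <= n)%N -> past_generators m `<=` past_generators n.
Proof.
move=> mn _ [A [B [mA mB ->]]].
exists (fun i => if (i < m)%N then A i else setT), (fun i => if (i < m)%N then B i else setT).
split=> [i|i|]; [by case: ifP|by case: ifP|].
apply/seteqP; split=> w h i /= ilt.
  by case: ifPn => // im; exact: h.
by have := h i (leq_trans ilt mn); rewrite ilt.
Qed.

Lemma past_state_generators n : past_generators n `<=` state_generators n.
Proof.
move=> _ [A [B [mA mB ->]]]; exists A, B, setT; split => //.
by rewrite preimage_setT setIT.
Qed.

Lemma past_generators_X i n C : (i < n)%N -> measurable C ->
  past_generators n (Xs i @^-1` C).
Proof.
move=> ilt mC; exists (set_at (fun=> setT) i C), (fun=> setT); split=> //.
  exact: measurable_set_at.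
apply/seteqP; split=> w.
  by move=> wC j _; split => //; rewrite /set_at /=; case: eqP => // ->.
by move=> /(_ i ilt)[+ _]; rewrite /= set_atE.
Qed.

Lemma past_generators_Z i n E : (i < n)%N -> measurable E ->
  past_generators n (Zs i @^-1` E).
Proof.
move=> ilt mE; exists (fun=> setT), (set_at (fun=> setT) i E); split=> //.
  exact: measurable_set_at.
apply/seteqP; split=> w.
  by move=> wC j _; split => //; rewrite /set_at /=; case: eqP => // ->.
by move=> /(_ i ilt)[_ +]; rewrite /= set_atE.
Qed.

Lemma state_generators_X n C : measurable C -> state_generators n (Xs n @^-1` C).
Proof.
move=> mC; exists (fun=> setT), (fun=> setT), C; split=> //.
by rewrite rectangleT setTI.
Qed.

Lemma measurable_past_X i n : (i < n)%N ->
  measurable_fun setT (Xs i : g_sigma_algebraType (past_generators n) -> Borel X).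
Proof.
move=> ilt _ C mC; rewrite setTI; apply: sub_sigma_algebra.
exact: past_generators_X.
Qed.

Lemma measurable_past_Z i n : (i < n)%N ->
  measurable_fun setT (Zs i : g_sigma_algebraType (past_generators n) -> Borel Z).
Proof.
move=> ilt _ C mC; rewrite setTI; apply: sub_sigma_algebra.
exact: past_generators_Z.
Qed.

Section conditional_laws.
Variables (m : probability (Borel X) R) (P : probability O R).
Hypothesis law : pomp_law T Q m P Xs Zs.

Lemma markov_property n D C : <<s past_generators n.+1 >> D -> measurable C ->
  P (D `&` Xs n.+1 @^-1` C) = \int[P]_(w in D) T (Xs n w) C.
Proof.
move=> sD mC; apply: (@density_sigma_algebra _ _ _ P (past_generators n.+1)) => //.
- exact: past_generators_measurable.
- exact: past_generatorsI.
- exact: past_generatorsT.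
- exact: mX.
- exact: (measurableT_comp (measurable_kernel T C mC)).
- by move=> _ [A [B [mA mB ->]]]; exact: (rectangle_markov law).
Qed.

Lemma noise_property n D E : <<s state_generators n >> D -> measurable E ->
  P (D `&` Zs n @^-1` E) = \int[P]_(w in D) Q E.
Proof.
move=> sD mE; apply: (@density_sigma_algebra _ _ _ P (state_generators n) _ (cst (Q E))) => //.
- exact: state_generators_measurable.
- exact: state_generatorsI.
- exact: state_generatorsT.
- exact: mZ.
- move=> _ [A [B [C [mA mB mC ->]]]]; rewrite integral_cst; last first.
    by apply: measurableI; [exact: measurable_rectangle|exact: mX].
  exact: (noise_independent law).
Qed.

End conditional_laws.

Section absolute_continuity.
Variables (mu nu : probability (Borel X) R) (Pmu Pnu : probability O R).
Hypotheses (lawmu : pomp_law T Q mu Pmu Xs Zs) (lawnu : pomp_law T Q nu Pnu Xs Zs).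
Hypothesis mu_ac_nu : mu `<< nu.

Let L := Radon_Nikodym_SigmaFinite.f mu nu.

Let L0 x : 0 <= L x.
Proof. exact: Radon_Nikodym_SigmaFinite.f_ge0. Qed.

Let mL : measurable_fun setT L.
Proof. exact: measurable_int (Radon_Nikodym_SigmaFinite.f_integrable mu_ac_nu). Qed.

(** The two trajectory laws differ only in the law of the initial state, so the density of [mu] with
    respect to [nu], evaluated at [Xs 0], is the density between them. *)
Let rectangle_density n A B :
  (forall i, measurable (A i)) -> (forall i, measurable (B i)) ->
  Pmu (rectangle n.+1 A B) = \int[Pnu]_(w in rectangle n.+1 A B) L (Xs 0%N w).
Proof.
move=> mA mB.
pose c : \bar R := \prod_(i < n.+1) Q (B i).
have c0 : 0 <= c by rewrite /c; elim/big_ind: _ => // *; exact: mule_ge0.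
pose f x := c * chain_int T A 0 n x.
have f0 x : 0 <= f x by rewrite mule_ge0// chain_int_ge0.
have mf : measurable_fun setT f.
  by apply: emeasurable_funM => //; exact: measurable_chain_int.
have mR := measurable_rectangle n.+1 mA mB.
(* On the rectangle, the law of the initial state under [Pnu] has density [f] with respect to
   [nu]. *)
have dens (C : set (Borel X)) : measurable C ->
    image_measure (mrestr Pnu mR) (mXs 0%N) C = \int[nu]_(x in C) f x.
  move=> mC; rewrite /image_measure /pushforward /mrestr.
  have -> : Xs 0%N @^-1` C `&` rectangle n.+1 A B = rectangle n.+1 (set_at A 0%N (A 0%N `&` C)) B.
    apply/seteqP; split=> w.
      move=> [wC h] i ilt; have [h1 h2] := h i ilt; split => //.
      by rewrite /set_at /=; case: eqP => // i0; subst i.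
    move=> h; split.
      by have [+ _] := h 0%N (ltn0Sn n); rewrite /= set_atE => -[].
    move=> i ilt; have [h1 h2] := h i ilt; split => //.
    by move: h1; rewrite /set_at /=; case: eqP => // -> [].
  rewrite [LHS]lawnu//; last by apply: measurable_set_at => //; exact: measurableI.
  rewrite ge0_integralZl//; last 2 first.
  - by apply: measurable_funTS; exact: measurable_chain_int.
  - by move=> x _; exact: chain_int_ge0.
  rewrite [in RHS]integral_mkcond; congr (_ * _); apply: eq_integral => x _.
  rewrite patchE; case: ifPn => xC.
    have [xA|xA] := pselect (A 0%N x); last first.
      by rewrite !chain_int_out// set_atE => -[].
    have h : (A 0%N `&` C) x by split => //; exact: set_mem.
    case: n {c c0 f f0 mf mR} => [|n] /=; rewrite set_atE !indicE !mem_set//.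
    congr (_ * _); apply: eq_integral => y _; apply: eq_chain_int => j j0 _.
    by rewrite /set_at gtn_eqF.
  by rewrite chain_int_out// set_atE => -[_ /mem_set]; rewrite (negbTE xC).
have mLX : measurable_fun setT (fun w => L (Xs 0%N w)) by exact: measurableT_comp.
rewrite -(ge0_integral_mrestr Pnu mR)//.
transitivity (\int[image_measure (mrestr Pnu mR) (mXs 0%N)]_x L x); last first.
  by rewrite ge0_integral_image// preimage_setT.
rewrite (ge0_integral_density mf f0 mL L0 dens).
under eq_integral do rewrite muleC.
rewrite (Radon_Nikodym_SigmaFinite.change_of_variables mu_ac_nu)//.
rewrite [LHS]lawmu// ge0_integralZl//; first exact: measurable_chain_int.
by move=> x _; exact: chain_int_ge0.
Qed.

(** The density formula extends from rectangles to the sigma-algebra of whole trajectories, and an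
    integral over a null event vanishes. *)
Lemma trajectory_dominates D : <<s \bigcup_n past_generators n >> D ->
  Pnu D = 0 -> Pmu D = 0.
Proof.
move=> sD Pnu0.
have Gm : \bigcup_n past_generators n `<=` measurable.
  by move=> A [n _]; exact: past_generators_measurable.
have mD : measurable D.
  by apply: smallest_sub sD; [exact: sigma_algebra_measurable|exact: Gm].
have mLX : measurable_fun setT (fun w => L (Xs 0%N w)) by exact: measurableT_comp.
have h (F : set O) : (\bigcup_n past_generators n) F ->
    Pmu F = \int[Pnu]_(w in F) L (Xs 0%N w).
  move=> [n _] /(past_generators_le (leqnSn n))[A [B [mA mB ->]]].
  exact: rectangle_density.
have GI : setI_closed (\bigcup_n past_generators n).
  move=> F F' [k _ kF] [l _ lF]; exists (maxn k l) => //; apply: past_generatorsI.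
    exact: (past_generators_le (leq_maxl k l)).
  exact: (past_generators_le (leq_maxr k l)).
have GT : (\bigcup_n past_generators n) setT by exists 0%N => //; exact: past_generatorsT.
have := @g_sigma_algebra_measure_unique _ R O _ Gm (fun=> setT) (fun=> GT)
  (bigcup_const _ _) Pmu (density_measure Pnu mLX (fun w => L0 (Xs 0%N w))) GI.
move=> -> //.
- by apply: null_set_integral => //; exact: measurable_funTS.
- by move=> _; rewrite ltey_eq fin_num_measure.
Qed.

End absolute_continuity.
End hidden_markov_model.

(** * Blocks of observations and their predicted laws *)

Section observation_blocks.
Context (R : realType) (X Y Z : completePseudoMetricType R).
Variables (T : R.-pker (Borel X) ~> (Borel X)) (Q : probability (Borel Z) R).
Variable h : X -> Z -> Y.
Hypothesis mh : measurable_fun [set: Borel X * Borel Z]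
  (fun p : Borel X * Borel Z => (h p.1 p.2 : Borel Y)).
Variable V : nat * nat -> set Y.
Hypothesis oV : forall i, open (V i).
Hypothesis baseV : forall U, open U -> forall x, U x -> exists i, V i x /\ V i `<=` U.
Local Notation S := (seq_space V).
Context (dO : measure_display) (O : measurableType dO).
Variables (Xs : nat -> O -> Borel X) (Zs : nat -> O -> Borel Z).
Hypothesis mXs : forall n, measurable_fun [set: O] (Xs n).
Hypothesis mZs : forall n, measurable_fun [set: O] (Zs n).
Local Notation past n := (past_generators Xs Zs n).
Local Notation state n := (state_generators Xs Zs n).

Definition observation i w : Borel Y := h (Xs i w) (Zs i w).

Definition obs_block n k w : S := [seq observation i w | i <- iota n k].

Lemma obs_blockS n k w :
  obs_block n k.+1 w = rcons (obs_block n k w) (observation (n + k) w).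
Proof. by rewrite /obs_block -addn1 iotaD map_cat cats1. Qed.

Lemma measurable_obs_block (G : set (set O)) n k :
  (forall i, (i < n + k)%N ->
    measurable_fun setT (observation i : g_sigma_algebraType G -> Borel Y)) ->
  measurable_fun setT (obs_block n k : g_sigma_algebraType G -> S).
Proof.
elim: k => [|k IH] mG; first exact: measurable_cst.
rewrite (_ : obs_block n k.+1 = fun w => rcons (obs_block n k w) (observation (n + k) w));
  last by apply/funext => w; rewrite obs_blockS.
have mp : measurable_fun setT ((fun w => (obs_block n k w, observation (n + k)%N w)) :
    g_sigma_algebraType G -> S * Borel Y).
  apply: measurable_fun_pair; last by apply: mG; rewrite addnS.
  by apply: IH => i ilt; apply: mG; rewrite addnS ltnW.
exact: (measurableT_comp (measurable_rcons oV baseV) mp).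
Qed.

Lemma measurable_observation_sub (G : set (set O)) i :
  measurable_fun setT (Xs i : g_sigma_algebraType G -> Borel X) ->
  measurable_fun setT (Zs i : g_sigma_algebraType G -> Borel Z) ->
  measurable_fun setT (observation i : g_sigma_algebraType G -> Borel Y).
Proof. by move=> mX mZ; exact: (measurableT_comp mh (measurable_fun_pair mX mZ)). Qed.

Lemma measurable_sub_le d (W : measurableType d) (G1 G2 : set (set O)) (f : O -> W) :
  <<s G1 >> `<=` <<s G2 >> ->
  measurable_fun setT (f : g_sigma_algebraType G1 -> W) ->
  measurable_fun setT (f : g_sigma_algebraType G2 -> W).
Proof. by move=> G12 mf _ A mA; apply: G12; exact: mf. Qed.

Lemma sub_generators_le (G1 G2 : set (set O)) : G1 `<=` G2 -> <<s G1 >> `<=` <<s G2 >>.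
Proof. by move=> G12; apply: sub_smallest2r => //; exact: smallest_sigma_algebra. Qed.

Lemma past_le m n : (m <= n)%N -> <<s past m >> `<=` <<s past n >>.
Proof. by move=> mn; apply: sub_generators_le; exact: past_generators_le. Qed.

Lemma measurable_past_observation i n : (i < n)%N ->
  measurable_fun setT (observation i : g_sigma_algebraType (past n) -> Borel Y).
Proof.
move=> ilt; apply: measurable_observation_sub.
  exact: measurable_past_X.
exact: measurable_past_Z.
Qed.

Lemma measurable_past_block n k l : (n + k <= l)%N ->
  measurable_fun setT (obs_block n k : g_sigma_algebraType (past l) -> S).
Proof.
move=> nkl; apply: measurable_obs_block => i ilt.
by apply: measurable_past_observation; exact: leq_trans ilt nkl.
Qed.

Lemma measurable_state_block n k :
  measurable_fun setT ((fun w => (obs_block n k w, Xs (n + k)%N w)) :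
    g_sigma_algebraType (state (n + k)) -> S * Borel X).
Proof.
apply: measurable_fun_pair.
  apply: (measurable_sub_le _ (measurable_past_block (leqnn (n + k)))).
  by apply: sub_generators_le; exact: past_state_generators.
move=> _ C mC; rewrite setTI; apply: sub_sigma_algebra.
exact: state_generators_X.
Qed.

Lemma past_measurable n : <<s past n >> `<=` measurable.
Proof.
apply: smallest_sub; first exact: sigma_algebra_measurable.
exact: past_generators_measurable.
Qed.

Section law.
Variables (m : probability (Borel X) R) (P : probability O R).
Hypothesis law : pomp_law T Q m P Xs Zs.
Local Open Scope ereal_scope.

(** Two successive conditionings: the next state is integrated out given the past including the
    current noise, and then this noise given the past and the current state. *)
Lemma block_step n k D (f : S * Borel X -> \bar R) : <<s past (n + k) >> D ->
  measurable_fun setT f -> (forall v, 0 <= f v) ->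
  \int[P]_(w in D) f (obs_block n k.+1 w, Xs (n + k).+1 w) =
  \int[P]_(w in D) \int[Q]_z \int[T (Xs (n + k) w)]_x
    f (rcons (obs_block n k w) (h (Xs (n + k) w) z), x).
Proof.
move=> sD mf f0; set N := (n + k)%N.
have mD := past_measurable sD.
pose f1 := f \o @observation_update _ X _ Z h V.
have mf1 : measurable_fun setT f1.
  exact: (measurableT_comp mf (measurable_observation_update mh oV baseV)).
have f10 p : 0 <= f1 p by exact: f0.
pose k1 : R.-pker (S * Borel X * Borel Z)%type ~> Borel X :=
  kernel_precomp T (@measurable_current_state _ X _ Z V).
pose k2 : R.-pker (S * Borel X)%type ~> Borel Z := kernel_cst Q.
pose f2 p := \int[k1 p]_x f1 (p, x).
have mf2 : measurable_fun setT f2 by exact: measurable_kernel_integral.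
have f20 p : 0 <= f2 p by exact: integral_ge0.
pose v w : S * Borel X := (obs_block n k w, Xs N w).
pose u w : S * Borel X * Borel Z := (v w, Zs N w).
have muN : measurable_fun setT (u : g_sigma_algebraType (past N.+1) -> _).
  apply: measurable_fun_pair; last exact: measurable_past_Z.
  apply: measurable_fun_pair; last exact: measurable_past_X.
  exact: measurable_past_block.
have mvN : measurable_fun setT (v : g_sigma_algebraType (state N) -> _).
  exact: measurable_state_block.
have sub_id (G : set (set O)) d (W : measurableType d) (g : O -> W) :
    G `<=` measurable -> measurable_fun setT (g : g_sigma_algebraType G -> W) ->
    measurable_fun setT g.
  by move=> Gm mg; exact: (measurableT_comp mg (g_sigma_algebra_id_measurable Gm)).
have mu : measurable_fun setT u.
  exact: (sub_id _ _ _ _ (past_generators_measurable mXs mZs (n := N.+1)) muN).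
have mv : measurable_fun setT v.
  exact: (sub_id _ _ _ _ (state_generators_measurable mXs mZs (n := N)) mvN).
transitivity (\int[P]_(w in D) f1 (u w, Xs N.+1 w)).
  by apply: eq_integral => w _; rewrite obs_blockS.
rewrite (integral_conditional_kernel mD mu (mXs N.+1) (k := k1))//; last first.
  move=> E C mE mC; apply: (markov_property mXs mZs law) => //.
  apply: (@measurableI _ (g_sigma_algebraType (past N.+1))).
    exact: past_le sD.
  by rewrite -[X in measurable X]setTI; exact: muN.
transitivity (\int[P]_(w in D) f2 (v w, Zs N w)); first by [].
rewrite (integral_conditional_kernel mD mv (mZs N) (k := k2))//.
move=> E C mE mC; apply: (noise_property mXs mZs law) => //.
apply: (@measurableI _ (g_sigma_algebraType (state N))).
  by apply: sub_generators_le sD; exact: past_state_generators.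
by rewrite -[X in measurable X]setTI; exact: mvN.
Qed.

Lemma measurable_obs_int (g : S -> R) k : bounded_measurable g ->
  measurable_fun setT (fun v : S * Borel X => obs_int T Q h g k v.1 v.2).
Proof.
move=> bg; have [K KE] := observation_kernel T Q mh oV baseV k.
rewrite (_ : (fun v => _) = fun v => (\int[K v]_y g y)%R%:E).
  by apply/measurable_EFinP; case: (bounded_measurable_kernel K bg).
by apply/funext => -[ys x]; rewrite KE.
Qed.

Lemma obs_int_ge0 (g : S -> R) k ys x : (forall ys, (0 <= g ys)%R) ->
  0 <= obs_int T Q h g k ys x.
Proof.
move=> g0; elim: k ys x => [|k IH] ys x /=; first by rewrite lee_fin.
by apply: integral_ge0 => z _; apply: integral_ge0.
Qed.

(** Each unfolding of [obs_int] is one step of the model and moves one observation into the block;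
    the induction therefore needs an arbitrary prefix length [k]. *)
Lemma block_law n k l D (g : S -> R) : <<s past (n + k) >> D ->
  bounded_measurable g -> (forall ys, (0 <= g ys)%R) ->
  \int[P]_(w in D) obs_int T Q h g l (obs_block n k w) (Xs (n + k) w) =
  \int[P]_(w in D) (g (obs_block n (k + l) w))%:E.
Proof.
move=> sD bg g0; elim: l k sD => [|l IH] k sD; first by rewrite addn0.
rewrite -addSnnS -IH; last by rewrite addnS; exact: past_le sD.
rewrite addnS.
rewrite (block_step sD (f := fun v => obs_int T Q h g l v.1 v.2))//.
  exact: measurable_obs_int.
by move=> v; exact: obs_int_ge0.
Qed.

End law.

Definition obs_generators n : set (set O) :=
  [set G | exists i, (i < n)%N /\
    exists B : set (Borel Y), measurable B /\ G = observation i @^-1` B].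

Lemma obs_generators_le m n : (m <= n)%N -> obs_generators m `<=` obs_generators n.
Proof. by move=> mn G [i [im iB]]; exists i; split => //; exact: leq_trans mn. Qed.

Lemma obs_generators_past n : <<s obs_generators n >> `<=` <<s past n >>.
Proof.
apply: smallest_sub; first exact: smallest_sigma_algebra.
move=> _ [i [ilt [B [mB ->]]]].
by rewrite -[X in <<s _ >> X]setTI; exact: measurable_past_observation.
Qed.

Lemma obs_generators_measurable n : obs_generators n `<=` measurable.
Proof.
move=> G nG; apply: (@past_measurable n); apply: obs_generators_past.
exact: sub_sigma_algebra.
Qed.

Lemma measurable_obs_generators_block n k :
  measurable_fun setT (obs_block n k : g_sigma_algebraType (obs_generators (n + k)) -> S).
Proof.
apply: measurable_obs_block => i ilt _ B mB; rewrite setTI.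
by apply: sub_sigma_algebra; exists i; split => //; exists B.
Qed.

Section prediction.
Variables (m : probability (Borel X) R) (P : probability O R).
Hypothesis law : pomp_law T Q m P Xs Zs.
Variable pi : nat -> O -> probability (Borel X) R.
Hypothesis hpi : is_predictor P Xs observation pi.
Local Open Scope ereal_scope.

Section time.
Variable n : nat.
Local Notation F := (g_sigma_algebraType (obs_generators n)).

(** The source carries the sigma-algebra of the first [n] observations, so that being a kernel
    includes adaptedness of the predictor. *)
Definition predictor_kernel (w : F) : {measure set (Borel X) -> \bar R} := pi n w.

Let predictor_measurable A : measurable A -> measurable_fun setT (predictor_kernel ^~ A).
Proof. by move=> mA _ U mU; rewrite setTI; have [+ _] := hpi n mA; exact. Qed.

HB.instance Definition _ := isKernel.Build _ _ _ _ _ predictor_kernel predictor_measurable.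

Let predictor_prob w : predictor_kernel w setT = 1.
Proof. exact: probability_setT. Qed.

HB.instance Definition _ := @Kernel_isProbability.Build _ _ _ _ R
  predictor_kernel predictor_prob.

Lemma integral_predictor D (f : Borel X -> \bar R) : <<s obs_generators n >> D ->
  measurable_fun setT f -> (forall x, 0 <= f x) ->
  \int[P]_(w in D) \int[pi n w]_x f x = \int[P]_(w in D) f (Xs n w).
Proof.
move=> sD mf f0.
have mD : measurable D by apply: (@past_measurable n); exact: obs_generators_past.
pose k : R.-pker F ~> Borel X := predictor_kernel.
have mid := g_sigma_algebra_id_measurable (@obs_generators_measurable n).
have := @integral_conditional_kernel _ _ F (Borel X) R _ O P D mD id (Xs n) mid (mXs n)
  k _ (fun p => f p.2).
move=> /(_ _ _ (fun p => f0 p.2)) -> //.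
- move=> E C mE mC; rewrite preimage_id.
  have [_ ->] := hpi n mC => //.
  exact: (@measurableI _ F).
- exact: measurableT_comp.
Qed.

(** [K w] mixes the block laws started from a state drawn from [pi n w]. It is the conditional law
    of the next [N] observations, and it turns integrals of [g] into integrals of [phi] against the
    predictor. The block starts at time [n], that of the predicted state, as [Y_1] goes with [X_1]
    in observability. *)
Lemma predicted_block N : exists K : R.-pker F ~> S,
  (forall D A, <<s obs_generators n >> D -> measurable A ->
     P (D `&` obs_block n N @^-1` A) = \int[P]_(w in D) K w A) /\
  (forall g : S -> R, bounded_measurable g -> exists phi : Borel X -> R,
     [/\ bounded_measurable phi,
       forall x, obs_int T Q h g N [::] x = (phi x)%:E &
       forall w, (\int[K w]_y g y = \int[pi n w]_x phi x)%R]).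
Proof.
have [K KE] := observation_kernel T Q mh oV baseV N.
have mnil : measurable_fun setT (fun p : F * Borel X => ([::] : S, p.2)).
  by apply: measurable_fun_pair => //; exact: measurable_cst.
pose l : R.-pker F ~> Borel X := predictor_kernel.
pose K0 : R.-pker (F * Borel X)%type ~> S := kernel_precomp K mnil.
have b0 g : bounded_measurable g -> bounded_measurable (fun x => \int[K ([::], x)]_y g y)%R.
  move=> bg; have [mk [M kM]] := bounded_measurable_kernel K bg.
  by split; [exact: (measurable_fun_pair2 ([::] : S) mk)|exists M => x; exact: kM].
exists (kernel_bind l K0); split=> [D A sD mA|g bg]; last first.
  exists (fun x => \int[K ([::], x)]_y g y)%R; split=> [|x|w].
  - exact: b0.
  - exact: KE.
  - by rewrite Rintegral_kernel_bind.
have b1 : bounded_measurable (\1_A : S -> R) by exact: bounded_measurable_indic.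
have KA x : K ([::], x) A = obs_int T Q h \1_A N [::] x.
  by rewrite KE// EFin_Rintegral_kernel// integral_indic// setIT.
(* The predictor is first replaced by the actual state [Xs n]; the block law, started from the empty
   prefix, then produces the observations. *)
transitivity (\int[P]_(w in D) \int[pi n w]_x obs_int T Q h \1_A N [::] x); last first.
  by apply: eq_integral => w _; apply: eq_integral => x _; rewrite -KA.
rewrite integral_predictor//; last 2 first.
- exact: (measurable_fun_pair2 ([::] : S) (measurable_obs_int N b1)).
- by move=> x; apply: obs_int_ge0 => ys; rewrite indicE ler0n.
have := @block_law m P law n 0 N D \1_A.
rewrite addn0 => -> //; last exact: obs_generators_past.
have mD : measurable D by apply: (@past_measurable n); exact: obs_generators_past.
have mb : measurable (obs_block n N @^-1` A).
  apply: (@past_measurable (n + N)%N); rewrite -[X in <<s _ >> X]setTI.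
  exact: measurable_past_block.
rewrite (eq_integral (fun w => (\1_(obs_block n N @^-1` A) w)%:E)).
  by rewrite integral_indic// setIC.
by move=> w _; rewrite add0n /= !indicE; congr (_%:R%:E); apply/idP/idP; rewrite !inE.
Qed.

End time.
End prediction.
End observation_blocks.

(** * Merging of the predictors *)

Section conditional_law_merging.
Context d (T : measurableType d) (R : realType).
Variable G : nat -> set (set T).
Hypothesis Gm : forall n, G n `<=` measurable.
Hypothesis G_mono : forall m n, (m <= n)%N -> <<s G m >> `<=` <<s G n >>.
Variables P Q : probability T R.
Hypothesis PQ : forall A, <<s \bigcup_k G k >> A -> Q A = 0%E -> P A = 0%E.
Context (U : pointedType) (c : nat -> set U).
Local Notation S := (g_sigma_algebraType (range c)).
Local Notation F n := (g_sigma_algebraType (G n)).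
Variables (N : nat) (Yb : nat -> T -> S).
Hypothesis mYb : forall n, measurable_fun setT (Yb n : F (n + N)%N -> S).
Variables KP KQ : forall n, R.-pker (F n) ~> S.
Hypothesis hKP : forall n D A, <<s G n >> D -> measurable A ->
  P (D `&` Yb n @^-1` A) = (\int[P]_(w in D) KP n w A)%E.
Hypothesis hKQ : forall n D A, <<s G n >> D -> measurable A ->
  Q (D `&` Yb n @^-1` A) = (\int[Q]_(w in D) KQ n w A)%E.

Let kernel_section01 n (K : R.-pker (F n) ~> S) (W : set (F n * S)) x :
  measurable W -> 0 <= fine (K x (xsection W x)) <= 1.
Proof.
move=> mW; have mx : measurable (xsection W x) by exact: measurable_xsection.
have K1 : (K x (xsection W x) <= 1)%E.
  exact: (@probability_le1 _ _ _ (kernel_probability K x) _ mx).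
rewrite fine_ge0//= -lee_fin fineK//.
by rewrite ge0_fin_numE//; apply: le_lt_trans K1 _; exact: ltry.
Qed.

Let adapted_section n (K : R.-pker (F n) ~> S) (W : set (F n * S)) : measurable W ->
  bounded_measurable ((fun x => fine (K x (xsection W x))) : F n -> R).
Proof.
move=> mW; apply: bounded_measurable01; last by move=> x; exact: kernel_section01.
apply: measurableT_comp => //.
by apply: measurable_fun_xsection_finite_kernel; rewrite inE.
Qed.

(** The conditional law of the block also gives the conditional probability of an event [W] of the
    block that is chosen from the past. *)
Let section_law n (L : probability T R) (K : R.-pker (F n) ~> S) (W : set (F n * S))
    (u : T -> R) :
  (forall D A, <<s G n >> D -> measurable A ->
    L (D `&` Yb n @^-1` A) = (\int[L]_(w in D) K w A)%E) ->
  measurable W -> bounded_measurable (u : F n -> R) ->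
  \int[L]_x (u x * fine (K x (xsection W x))) = \int[L]_x (u x * \1_W (x, Yb n x)).
Proof.
move=> hK mW bu.
have mid := g_sigma_algebra_id_measurable (Gm (n := n)).
have mY : measurable_fun setT (Yb n).
  move=> _ A mA; rewrite setTI.
  apply: (smallest_sub (@sigma_algebra_measurable _ T) (@Gm (n + N)%N)).
  by rewrite -[X in <<s _ >> X]setTI; exact: mYb.
pose f (z : F n * S) := u z.1 * \1_W z.
have bf : bounded_measurable f.
  have [mu [M uM]] := bu.
  have bu1 : bounded_measurable (fun z : F n * S => u z.1).
    by split; [exact: (measurableT_comp mu measurable_fst)|exists M => z; exact: uM].
  by apply: bounded_measurableM => //; exact: bounded_measurable_indic.
have := @Rintegral_conditional_kernel _ _ (F n) S R _ T L id (Yb n) K mid mY _ f bf.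
rewrite /f /= => -> //.
apply: eq_Rintegral => x _.
have mx : measurable (xsection W x) by exact: measurable_xsection.
have e y : \1_W (x, y) = \1_(xsection W x) y :> R.
  by rewrite !indicE mem_xsection.
have bx : bounded_measurable (\1_(xsection W x) : S -> R).
  exact: bounded_measurable_indic.
under [RHS]eq_Rintegral do rewrite e.
rewrite RintegralZl//; last exact: bounded_measurable_kernel_integrable.
by rewrite /Rintegral integral_indic// setIT.
Qed.

(* The event [W n] picks the first set of a generating countable algebra on which
   the two conditional laws differ by more than [e]; it is enough to compare the
   conditional probabilities of that single event. *)
Lemma conditional_law_merging : {ae P, forall x e, 0 < e ->
  \forall n \near \oo, forall A, measurable A ->
    `|fine (KP n x A) - fine (KQ n x A)| <= e}.
Proof.
have [a [ra aT ac am]] := countable_algebra c.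
pose D n j x := `|fine (KP n x (a j)) - fine (KQ n x (a j))|.
have main (e : R) : 0 < e ->
    {ae P, forall x, \forall n \near \oo, forall j, D n j x <= e}.
  move=> e0.
  pose E n j : set (F n) := [set x | e < D n j x].
  have mE n j : measurable (E n j).
    have mD : measurable_fun setT (D n j : F n -> R).
      have mK (K : R.-pker (F n) ~> S) : measurable_fun setT (fun x => fine (K x (a j))).
        by apply: measurableT_comp => //; exact: (measurable_kernel K (a j) (am j)).
      by apply: measurableT_comp => //; exact: measurable_funB.
    rewrite -[E n j]setTI (_ : E n j = D n j @^-1` `]e, +oo[).
      by apply: mD => //; exact: measurable_itv.
    by apply/seteqP; split => x; rewrite /E/= in_itv/= andbT.
  pose W n : set (F n * S) := \bigcup_j (seqDU (E n) j `*` a j).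
  have mW n : measurable (W n).
    apply: bigcup_measurable => j _; apply: measurableX; last exact: am.
    exact: seqDU_measurable.
  pose p n x := fine (KP n x (xsection (W n) x)).
  pose q n x := fine (KQ n x (xsection (W n) x)).
  pose g n x : R := \1_(W n) (x, Yb n x).
  have : {ae P, forall x, (fun n => p n x - q n x) @ \oo --> 0}.
    apply: (@ae_merging _ T R G Gm G_mono P Q N p q g PQ).
    - by move=> n; exact: adapted_section.
    - by move=> n; exact: adapted_section.
    - move=> n; apply: bounded_measurable01; last first.
        by move=> x; rewrite /g indicE; case: (_ \in _); rewrite /= ler01 lexx.
      have mpair : measurable_fun setT
          ((fun x => (x, Yb n x)) : F (n + N)%N -> F n * S).
        apply: measurable_fun_pair; last exact: mYb.
        by move=> _ B mB; rewrite setTI preimage_id; exact: (G_mono (leq_addr N n)).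
      have mi : measurable_fun setT (\1_(W n) : F n * S -> R) by exact: measurable_indic.
      exact: (measurableT_comp mi mpair).
    - by move=> n x; rewrite /g indicE; case: (_ \in _); rewrite /= ler01 lexx.
    - by move=> n u bu; apply: section_law => // *; exact: hKP.
    - by move=> n u bu; apply: section_law => // *; exact: hKQ.
  apply: filterS => x /cvgr0Pnorm_lt /(_ e e0); apply: filterS => n pq j.
  rewrite leNgt; apply/negP => eD.
  have : (\bigcup_k E n k) x by exists j.
  rewrite seqDU_bigcup_eq => -[j0 _ Ej0].
  (* The events of [seqDU] are disjoint, so the section at [x] is the single set [a j0], on which
     the laws differ by more than [e]. *)
  have Wx : xsection (W n) x = a j0.
    apply/seteqP; split=> y; rewrite /xsection /= inE.
      move=> [k _ [/= Ek aky]].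
      suff -> : j0 = k by [].
      by apply: (@trivIset_seqDU _ (E n)) => //; exists x.
    by move=> ay; exists j0.
  have : E n j0 x by exact: (subset_seqDU Ej0).
  by move: pq; rewrite /p /q Wx /E /= /D => h1 h2; have := lt_trans h1 h2; rewrite ltxx.
(* Countably many thresholds suffice, which gives one null event for all [e]. *)
have : {ae P, forall x, forall k : nat,
    \forall n \near \oo, forall j, D n j x <= k.+1%:R^-1}.
  by apply: ae_foralln => k; apply: main; rewrite invr_gt0.
apply: filterS => x h e e0.
have [k _ /(_ k (leqnn k)) /= ke] := near_infty_natSinv_lt (PosNum e0).
apply: filterS (h k) => n hn A mA.
apply: (@total_variation_sigma_algebra _ _ _ (kernel_probability (KP n) x)
  (kernel_probability (KQ n) x) e (range a)) => //.
- by move=> _ [j _ <-]; exact: am.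
- by move=> _ [j _ <-]; apply: le_trans (hn j) _; exact: ltW.
- apply: smallest_sub mA; first exact: smallest_sigma_algebra.
  by move=> _ [i _ <-]; apply: sub_sigma_algebra; exact: ac.
Qed.

End conditional_law_merging.

Lemma continuous_Borel_measurable (R : realType) (X : completePseudoMetricType R)
  (f : X -> R) : continuous f -> measurable_fun setT (f : Borel X -> R).
Proof.
move=> cf; apply: (measurability _ (RGenOInfty.measurableE R)) => _ [_ [r ->] <-].
rewrite setTI; apply: sub_sigma_algebra.
by apply: open_comp; [move=> x _; exact: cf|rewrite set_itvE; exact: open_gt].
Qed.

(** After [m] steps the prefix has length [size ys + m], so [g] is evaluated only at sequences of
    that length. *)
Lemma eq_obs_int (R : realType) (X Y Z : completePseudoMetricType R)
    (T : R.-pker (Borel X) ~> (Borel X)) (Q : probability (Borel Z) R) (h : X -> Z -> Y)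
    (g g' : seq Y -> R) m ys x :
  (forall ys', size ys' = (size ys + m)%N -> g ys' = g' ys') ->
  obs_int T Q h g m ys x = obs_int T Q h g' m ys x.
Proof.
elim: m ys x => [|m IH] ys x gg' /=; first by rewrite gg' ?addn0.
apply: eq_integral => z _; apply: eq_integral => x' _; apply: IH => ys' sz.
by apply: gg'; rewrite sz size_rcons addSnnS.
Qed.

Lemma le_Rintegral_dist d (T : measurableType d) (R : realType) (P : probability T R)
    (f g : T -> R) e : bounded_measurable f -> bounded_measurable g ->
  (forall x, `|f x - g x| <= e) -> `|\int[P]_x f x - \int[P]_x g x| <= e.
Proof.
move=> bf bg fge.
rewrite -RintegralB//; [|exact: bounded_measurable_integrable..].
have bfg := bounded_measurableB bf bg.
have ifg := bounded_measurable_integrable P bfg.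
apply: le_trans (le_normr_Rintegral measurableT ifg) _.
have -> : e = \int[P]_x (cst e x).
  by rewrite Rintegral_cst//= [X in fine X](probability_setT P) mulr1.
apply: le_Rintegral => //; first exact: integrable_norm.
by apply: bounded_measurable_integrable; exact: bounded_measurable_cst.
Qed.

Theorem theorem1 (R : realType) (X Y Z : completePseudoMetricType R)
  (polX : polish X) (polY : polish Y) (polZ : polish Z)
  (T : R.-pker (Borel X) ~> (Borel X)) (Q : probability (Borel Z) R)
  (h : X -> Z -> Y)
  (mh : measurable_fun [set: Borel X * Borel Z]
          (fun p : Borel X * Borel Z => (h p.1 p.2 : Borel Y)))
  (dO : measure_display) (O : measurableType dO)
  (Xs : nat -> O -> Borel X) (Zs : nat -> O -> Borel Z)
  (mXs : forall n, measurable_fun [set: O] (Xs n))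
  (mZs : forall n, measurable_fun [set: O] (Zs n))
  (mu nu : probability (Borel X) R) (mu_ac_nu : mu `<< nu)
  (Pmu Pnu : probability O R)
  (lawmu : pomp_law T Q mu Pmu Xs Zs) (lawnu : pomp_law T Q nu Pnu Xs Zs)
  (obs : observable T Q h)
  (pimu pinu : nat -> O -> probability (Borel X) R)
  (hpimu : is_predictor Pmu Xs (fun n w => h (Xs n w) (Zs n w) : Borel Y) pimu)
  (hpinu : is_predictor Pnu Xs (fun n w => h (Xs n w) (Zs n w) : Borel Y) pinu) :
  exists E : set O, [/\ measurable E, Pmu E = 1%E &
    forall w, E w -> forall f : X -> R, Cb f ->
      (fun n => `| \int[pimu n w]_x (f x)%:E - \int[pinu n w]_x (f x)%:E |)%E
        @ \oo --> 0%E].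
Proof.
have [_ sepY] := polY.
have [V [oV baseV]] := separable_countable_base sepY.
have [N obsN] := obs.
pose S := seq_space V.
pose G n := obs_generators h Xs Zs n.
have bmu n := predicted_block mh oV baseV mXs mZs lawmu hpimu n N.
have bnu n := predicted_block mh oV baseV mXs mZs lawnu hpinu n N.
pose Kmu n := projT1 (cid (bmu n)); pose Knu n := projT1 (cid (bnu n)).
have Kmu_law n := (projT2 (cid (bmu n))).1; have Knu_law n := (projT2 (cid (bnu n))).1.
have Kmu_int n := (projT2 (cid (bmu n))).2; have Knu_int n := (projT2 (cid (bnu n))).2.
have G_mono m n : (m <= n)%N -> <<s G m >> `<=` <<s G n >>.
  by move=> mn; apply: sub_generators_le; exact: obs_generators_le.
(* Observation events are trajectory events, so absolute continuity passes to them. *)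
have G_dom A : <<s \bigcup_k G k >> A -> Pnu A = 0%E -> Pmu A = 0%E.
  move=> sA; apply: (trajectory_dominates mXs mZs lawmu lawnu mu_ac_nu).
  apply: smallest_sub sA; first exact: smallest_sigma_algebra.
  move=> B [n _ nB]; apply: (sub_generators_le (G1 := past_generators Xs Zs n)).
    by move=> C; exists n.
  by apply: (obs_generators_past mh); exact: sub_sigma_algebra.
(* This null event is fixed before [f], because merging is uniform over all block events. *)
have [E0 [mE0 E00 hE0]] := conditional_law_merging
  (fun n => obs_generators_measurable mh mXs mZs (n := n)) G_mono G_dom
  (fun n => @measurable_obs_generators_block _ _ _ _ h V oV baseV _ _ Xs Zs n N) Kmu_law Knu_law.
exists (~` E0); split; first exact: measurableC.
  by rewrite probability_setC// E00 sube0.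
move=> w nE0 f [cf [Mf fMf]].
have merge : forall e, 0 < e -> \forall n \near \oo, forall A : set S, measurable A ->
    `|fine (Kmu n w A) - fine (Knu n w A)| <= e.
  by apply: contrapT => h0; exact/nE0/hE0.
have bf : bounded_measurable (f : Borel X -> R).
  by split; [exact: continuous_Borel_measurable|exists Mf].
have fE (l : probability (Borel X) R) : (\int[l]_x (f x)%:E)%E = (\int[l]_x f x)%:E.
  by rewrite EFin_Rintegral.
under eq_fun do rewrite !fE -EFinB /abse.
apply/cvg_EFin; first exact: nearW.
apply/cvgr0Pnorm_le => e e0.
have e30 : 0 < e / 3 by rewrite divr_gt0.
have [g [mg [M gM] [d de fd]]] := obsN f (conj cf (ex_intro _ Mf fMf)) _ e30.
pose g' ys := if size ys == N then g ys else 0.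
have M0 : 0 <= M by exact: le_trans (gM [::]).
have g'M ys : `|g' ys| <= M by rewrite /g'; case: ifP => // _; rewrite normr0.
have bg' : bounded_measurable (g' : S -> R).
  by split; [exact: measurable_YN_restrict|exists M].
have obs_g' x : obs_int T Q h g N [::] x = obs_int T Q h g' N [::] x.
  by apply: eq_obs_int => ys /= sz; rewrite /g' sz eqxx.
(* This threshold makes the total variation bound [2 * M * c] at most [e / 3]; [M + 1] avoids a
   division by 0 when [M = 0]. *)
have c0 : 0 < e / 3 / (2 * (M + 1)).
  by rewrite !divr_gt0// mulr_gt0// ltr_wpDl.
apply: filterS (merge _ c0) => n tv.
have [phi [bphi phiE phi_mu]] := Kmu_int n _ bg'.
have [phi' [_ phiE' phi_nu]] := Knu_int n _ bg'.
(* Both functions are given by [obs_int]: the law of the block given the state does not depend on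
   the prior. *)
have phi_eq : phi' = phi.
  by apply/funext => x; apply: EFin_inj; rewrite -phiE -phiE'.
subst phi'.
have fphi x : `|f x - phi x| <= e / 3.
  by have := fd x; rewrite obs_g' phiE -EFinB abse_EFin lee_fin => /le_trans; apply; exact: ltW.
have dmu := le_Rintegral_dist (pimu n w) bf bphi fphi.
have dnu := le_Rintegral_dist (pinu n w) bf bphi fphi.
rewrite -phi_mu in dmu; rewrite -phi_nu in dnu.
have mg' : measurable_fun setT (g' : S -> R) by case: bg'.
have := @total_variation_integral _ _ _ (kernel_probability (Kmu n) w)
  (kernel_probability (Knu n) w) _ (ltW c0) tv g' M mg' g'M.
have -> : \int[kernel_probability (Kmu n) w]_x g' x = \int[Kmu n w]_x g' x by [].
have -> : \int[kernel_probability (Knu n) w]_x g' x = \int[Knu n w]_x g' x by [].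
have le3 : 2 * M * (e / 3 / (2 * (M + 1))) <= e / 3.
  rewrite mulrCA ger_pMr//.
  by rewrite ler_pdivrMr ?mulr_gt0 ?ltr_wpDl// mul1r ler_pM2l// lerDl.
move=> /le_trans /(_ le3) dK.
rewrite normr_id.
(* The error [e] splits into two observability errors, one for each predictor, and the distance
   between the predicted block laws tested on [g']. *)
move: dmu dnu dK; rewrite !ler_norml => /andP[a1 a2] /andP[b1 b2] /andP[c1 c2].
by apply/andP; split; lra.
Qed.
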